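(* Assume (A2), (A3), (A4), (A5), (A7), (A8) stated in the context. Then the iterates $\{x_t\}$ satisfy the $(L^p,\max\{a_t,1\}\sqrt{\eta_t})$-consistency, with $p>2$ from (A2): there exists a constant $C_p\ge1$ such that for all $t\ge0$, \[ (\mathbb E\|x_t-x^\star\|^p)^{1/p}\le C_p\max\{a_t,1\}\sqrt{\eta_t}, \] where $a_t:=0$ if $\rho=0$ and $a_t:=\lceil\log_\rho\frac{\eta_t}{\sigma\kappa}\rceil$ if $\rho\in(0,1)$ (with the convention $a_t=0$ if $\sigma=0$).
   Context: Setting. $\Xi$ is a Polish space and $\{\xi_t\}_{t\ge0}$ is a time-homogeneous Markov chain on $\Xi$ with transition kernel $P$ and stationary distribution $\pi$ (arbitrary initial distribution). For $F(x,\xi)$, $\mathcal PF(x,\xi):=\int_\Xi F(x,\xi')P(\xi,d\xi')$. $\|\cdot\|$ is a norm on $\mathbb R^d$. $H:\mathbb R^d\times\Xi\to\mathbb R^d$ measurable, $g(x):=\int H(x,\xi)\pi(d\xi)$, $g(x^\star)=0$, and $x_{t+1}=x_t-\eta_tH(x_t,\xi_t)$. (A2) There exist $p>2$ and $\sigma>0$ with $\sup_t(\mathbb E\|H(x^\star,\xi_t)\|^p)^{1/p}<\infty$ and $\sup_\xi\|\mathcal PH(x^\star,\xi)\|\le\sigma$. (A3) There is $L_H$ with $(\int\|H(x,\xi')-H(y,\xi')\|^pP(\xi,d\xi'))^{1/p}\le L_H\|x-y\|$ for all $x,y,\xi$. (A4) $\pi$ is the unique stationary distribution and $d_{TV}(P^t(\xi,\cdot),\pi)\le\kappa\rho^t/2$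 for all $\xi\in\Xi$, $t\ge0$, for some $\kappa\ge e$, $\rho\in[0,1)$. (A5) (i) $0<\eta_t\le1$, $\eta_t\downarrow0$, $\eta_t\log^2t\to0$, $t\eta_t\uparrow\infty$; (ii) $(\eta_{t-1}-\eta_t)/\eta_{t-1}=o(\eta_{t-1})$; (iii) $\sum_{t\ge1}\frac{\log t}{\sqrt t}\eta_t<\infty$; (iv) $\sum_{t=0}^T\eta_t/(T\eta_T)\le C$ for all $T\ge1$. (A7) (Contraction) There exist $\gamma\in[0,1)$ and $c>0$ such that $\|\mathcal P(H(x,\xi)-H(y,\xi))-c(x-y)\|\le\gamma c\|x-y\|$ for all $x,y\in\mathbb R^d$, $\xi\in\Xi$. (A8) (Growth) There exist $M>0$ and a nonnegative function $\bar g:\Xi\to\mathbb R$ with $\|H(x,\xi)\|\le M(\|x\|+\bar g(\xi))$ for all $x,\xi$, and $\sup_{t\ge0}\mathbb E|\bar g(\xi_t)|^p<\infty$ with $p$ from (A2). *)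

(* Defs.v *)
From HB Require Import structures.
From mathcomp Require Import all_boot all_order all_algebra.
From mathcomp Require Import all_classical all_reals all_analysis.
Set Implicit Arguments. Unset Strict Implicit. Unset Printing Implicit Defensive.
Import Order.TTheory GRing.Theory Num.Theory.
Import numFieldNormedType.Exports.
Local Open Scope classical_set_scope.
Local Open Scope ring_scope.

Definition is_norm (R : realType) (d : nat) (nrm : 'rV[R]_d -> R) : Prop :=
  [/\ forall x, nrm x = 0 -> x = 0,
      forall (a : R) x, nrm (a *: x) = `|a| * nrm x &
      forall x y, nrm (x + y) <= nrm x + nrm y].

Definition prod_rect_sets (R : realType) (d : nat) (dX : measure_display)
  (Xi : measurableType dX) : set (set ('rV[R]_d * Xi)) :=
  [set U `*` A | U in [set U | open U] & A in [set A | measurable A]].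

Definition jointly_measurable (R : realType) (d : nat) (dX : measure_display)
  (Xi : measurableType dX) (H : 'rV[R]_d -> Xi -> 'rV[R]_d) : Prop :=
  forall (i : 'I_d) (B : set R), measurable B ->
    <<s @prod_rect_sets R d dX Xi >> [set z | B (H z.1 z.2 0 i)].

Definition Pvec (R : realType) (d : nat) (dX : measure_display)
  (Xi : measurableType dX) (k : R.-pker Xi ~> Xi) (F : Xi -> 'rV[R]_d)
  (xi : Xi) : 'rV[R]_d :=
  \row_i Rintegral (k xi) setT (fun xi' => F xi' 0 i).

Fixpoint Piter (R : realType) (dX : measure_display) (Xi : measurableType dX)
  (k : R.-pker Xi ~> Xi) (t : nat) : Xi -> set Xi -> \bar R :=
  match t with
  | O => fun xi A => \d_xi A
  | S t' => fun xi A => (\int[k xi]_y Piter k t' y A)%E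
  end.

Definition dTV (R : realType) (dX : measure_display) (Xi : measurableType dX)
  (mu nu : set Xi -> \bar R) : \bar R :=
  ereal_sup [set `|(mu A - nu A)%E|%E | A in [set A : set Xi | measurable A]].

Definition stationary (R : realType) (dX : measure_display) (Xi : measurableType dX)
  (k : R.-pker Xi ~> Xi) (mu : probability Xi R) : Prop :=
  forall A, measurable A -> (\int[mu]_y k y A)%E = mu A.

Definition markov_chain (R : realType) (dO : measure_display) (Omega : measurableType dO)
  (Pr : probability Omega R) (dX : measure_display) (Xi : measurableType dX)
  (k : R.-pker Xi ~> Xi) (xi : nat -> Omega -> Xi) : Prop :=
  (forall t, measurable_fun setT (xi t)) /\
  forall (t : nat) (A : nat -> set Xi) (B : set Xi),
    (forall s, measurable (A s)) -> measurable B ->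
    Pr ([set w | forall s, (s <= t)%N -> A s (xi s w)] `&` (xi t.+1 @^-1` B))
    = (\int[Pr]_(w in [set w | forall s, (s <= t)%N -> A s (xi s w)]) k (xi t w) B)%E.

Fixpoint iterates (R : realType) (d : nat) (Omega Xi : Type)
  (H : 'rV[R]_d -> Xi -> 'rV[R]_d) (eta : nat -> R) (x0 : 'rV[R]_d)
  (xi : nat -> Omega -> Xi) (t : nat) (w : Omega) : 'rV[R]_d :=
  match t with
  | O => x0
  | S t' => let x := iterates H eta x0 xi t' w in x - eta t' *: H x (xi t' w)
  end.

Definition a_seq (R : realType) (rho sigma kappa : R) (eta : nat -> R) (t : nat) : R :=
  if (rho == 0) || (sigma == 0) then 0
  else (Num.ceil (ln (eta t / (sigma * kappa)) / ln rho))%:~R.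

(* Main.v *)
Require Import Defs.
From HB Require Import structures.
From mathcomp Require Import all_boot all_order all_algebra.
From mathcomp Require Import all_classical all_reals all_analysis.
From mathcomp Require Import measurable_realfun ring lra.

Set Implicit Arguments.
Unset Strict Implicit.
Unset Printing Implicit Defensive.
Import Order.TTheory GRing.Theory Num.Theory.
Import numFieldNormedType.Exports.
Local Open Scope classical_set_scope.
Local Open Scope ring_scope.

(** The bound holds without the factor [a_t]: [E |x_t - x*| ^ p <= C eta_t ^ (p / 2)],
    and [max a_t 1 >= 1].

    By geometric mixing the series [U] of the [P^j (P H(x*, .))], [j >= 0], converges
    uniformly and solves the Poisson equation [U - P U = P H(x*, .)].  With
    [D_t = H(x_t, xi_t) + U(xi_t) - P(H(x_t, .) - H(x*, .))(xi_{t-1}) - U(xi_{t-1})],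
    a martingale difference, let [V_{t+1} = (1 - c eta_t) V_t - eta_t D_t].
    The residual [r_t = x_t - x* - eta_t U(xi_{t-1}) - V_t] then contains no noise:
    by (A7) it contracts pathwise in the given norm,
    [|r_{t+1}| <= (1 - c (1 - gamma) eta_t) |r_t| + O(eta_t) (|V_t| + eta_t)].
    Only the linear recursion for [V_t] sees the martingale noise, and it can be
    treated coordinate by coordinate with [|.| ^ p], so no smoothing of the norm is
    required.  A combination [E (|r_t| ^ p + lam \sum_i |V_{t,i}| ^ p)] satisfies
    [W_{t+1} <= (1 - alpha eta_t) W_t + K eta_t ^ (1 + p / 2) (1 + W_t)], which gives
    the rate [eta_t ^ (p / 2)] since [eta_t - eta_{t+1} = o(eta_t ^ 2)]. *)

(** * Inequalities for real powers *)

(** The obstacle is that [nrm] is arbitrary: its [p]-th power need not have a second-order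
    expansion, so a martingale increment cannot be averaged out in it, whereas (A7) contracts in
    [nrm] alone. Hence the split. [V] carries the noise and is linear, so each coordinate can use
    the expansion of [|.| ^ p] on the line; the residual carries the nonlinearity and is estimated
    by the triangle inequality only. Giving [V] the factor [1 - c eta_t] makes the drift enter the
    residual solely through its distance to [c (x_t - xstar)], the quantity bounded in (A7). The
    coupling of the two parts is lopsided. [V] acts on the residual with a weight of order [eta_t],
    comparable with the contraction, and a large [lam] absorbs it. The residual acts back on [V]
    only through the size of the noise, with weight [eta_t ^ (1 + p / 2)], so enlarging [lam] costs
    nothing at leading order. *)

Section power_inequalities.
Context {R : realType}.
Implicit Types a b c p q s t x y z eta : R.

Lemma le_powR p x y : 0 <= p -> 0 <= x -> x <= y -> x `^ p <= y `^ p.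
Proof.
move=> p0 x0 xy; apply: ge0_ler_powR => //; rewrite nnegrE//.
exact: le_trans xy.
Qed.

Lemma powRD_ge0 p q x : 0 < p -> 0 < q -> 0 <= x ->
  x `^ (p + q) = x `^ p * x `^ q.
Proof.
by move=> p0 q0 x0; rewrite powRD// gt_eqF ?implyFb//; lra.
Qed.

Lemma powR2 x : 0 <= x -> x `^ 2 = x ^+ 2.
Proof. by move=> x0; rewrite -powR_mulrn. Qed.

Lemma powRD_le p x y : 0 <= p -> 0 <= x -> 0 <= y ->
  (x + y) `^ p <= 2 `^ p * (x `^ p + y `^ p).
Proof.
move=> p0; wlog xy : x y / x <= y.
  move=> wl x0 y0; have [xy|/ltW yx] := leP x y; first exact: wl.
  by rewrite addrC [X in _ * X]addrC; exact: wl.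
move=> x0 y0; apply: (@le_trans _ _ ((2 * y) `^ p)).
  by apply: le_powR => //; lra.
by rewrite powRM// ler_wpM2l ?powR_ge0// lerDr powR_ge0.
Qed.

Lemma powR_convex p t x y : 1 <= p -> 0 <= t <= 1 -> 0 <= x -> 0 <= y ->
  ((1 - t) * x + t * y) `^ p <= (1 - t) * x `^ p + t * y `^ p.
Proof.
move=> p1 t01 x0 y0; have [t0 t1] := andP t01.
pose u : {i01 R} := Itv01 t0 t1.
have := @convex_powR R p p1 u y x.
rewrite !inE/= !in_itv/= x0 y0 => /(_ isT isT).
by rewrite addrC [leRHS]addrC; apply.
Qed.

(** From [expR (- x) >= 1 - x] follows [expR x <= (1 - x)^-1], and [(1 - x) (1 + x + 2 x ^ 2) = 1 +
    x ^ 2 (1 - 2 x)] is at least 1. *)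
Lemma expR_le_quadratic x : `|x| <= 2^-1 -> expR x <= 1 + x + 2 * x ^+ 2.
Proof.
rewrite ler_norml => /andP[xl xu].
have x1 : 0 < 1 - x by lra.
apply: (@le_trans _ _ (1 - x)^-1); last first.
  by rewrite -[leLHS]mul1r ler_pdivrMr//; nra.
rewrite -[x in expR x]opprK expRN lef_pV2 ?posrE ?expR_gt0//.
exact: expR_ge1Dx.
Qed.

(** A Bernoulli inequality for real exponents, through [1 - x >= expR (- 2 x)] on [[0, 1/2]]; the
    factor 2 is the price of that comparison. It serves to compare consecutive values of
    [eta_t ^ (p / 2)]. *)
Lemma powR_1B_ge q x : 0 <= q -> 0 <= x <= 2^-1 ->
  1 - 2 * q * x <= (1 - x) `^ q.
Proof.
move=> q0 /andP[x0 x1].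
have u0 : 0 < 1 - x by lra.
apply: (@le_trans _ _ (expR (- (2 * q * x)))); first exact: expR_ge1Dx.
rewrite mulrAC -mulNr expRM; apply: le_powR => //.
rewrite -[leRHS]invrK expRN lef_pV2 ?posrE ?invr_gt0 ?expR_gt0//.
apply: (@le_trans _ _ (1 + 2 * x)); last exact: expR_ge1Dx.
by rewrite -[leLHS]mul1r ler_pdivrMr//; nra.
Qed.

(** If [|p s| <= 1/2], then [(1 + s) ^ p <= expR (p s)], which is at most quadratic: this gives the
    summand [2 p ^ 2]. Otherwise [1 <= 2 p |s|], and everything is of the order of [|s| ^ p]: the
    second summand pays for the left side, the third for a negative linear term. *)
Lemma norm1D_powR_le p s : 1 <= p ->
  `|1 + s| `^ p <=
  1 + p * s + (2 * p ^+ 2 + (2 * p + 1) `^ p + (2 * p) `^ p) *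
              (s ^+ 2 + `|s| `^ p).
Proof.
move=> p1.
have ge0 := @powR_ge0 R.
have [small|large] := leP (`|p * s|) 2^-1.
  have s0 : 0 <= 1 + s.
    by move: small; rewrite ler_norml => /andP[]; nra.
  apply: (@le_trans _ _ (1 + p * s + 2 * (p * s) ^+ 2)).
    apply: le_trans (expR_le_quadratic small).
    rewrite mulrC expRM; apply: le_powR; [lra|exact: normr_ge0|].
    by rewrite ger0_norm// expR_ge1Dx.
  rewrite lerD2l exprMn mulrA; set A := 2 * _.
  have A0 : 0 <= A by rewrite /A mulr_ge0// sqr_ge0.
  rewrite mulrDr -[leLHS]addr0; apply: lerD.
    by rewrite ler_wpM2r ?sqr_ge0// -addrA lerDl addr_ge0.
  by rewrite mulr_ge0// addr_ge0// addr_ge0.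
have large' : 1 <= 2 * p * `|s|.
  by move: large; rewrite normrM (ger0_norm (_ : 0 <= p)); lra.
have s0 := normr_ge0 s.
have step1 : `|1 + s| `^ p <= (2 * p + 1) `^ p * `|s| `^ p.
  rewrite -powRM//; last lra.
  apply: le_powR => //; first lra.
  by apply: (le_trans (ler_normD _ _)); rewrite normr1; lra.
have step2 : - (p * s) <= (2 * p) `^ p * `|s| `^ p.
  rewrite -powRM//; last lra.
  apply: (@le_trans _ _ (2 * p * `|s|)); last exact: le1r_powR.
  by have := ler_norm (- s); rewrite normrN; nra.
have H2 : 0 <= 2 * p ^+ 2 by rewrite mulr_ge0// sqr_ge0.
have := ge0 (2 * p + 1) p; have := ge0 (2 * p) p; have := ge0 `|s| p.
have := sqr_ge0 s.
move: (`|1 + s| `^ p) ((2 * p + 1) `^ p) ((2 * p) `^ p) (`|s| `^ p) (s ^+ 2)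
  (2 * p ^+ 2) H2 step1 step2 => X A B S S2 D D0 h1 h2 S20 S0 B0 A0.
have : 0 <= D * (S2 + S) by rewrite mulr_ge0// addr_ge0.
have : 0 <= A * S2 by rewrite mulr_ge0.
have : 0 <= B * S2 by rewrite mulr_ge0.
lra.
Qed.

(** The normalised inequality at [s = b / a], scaled by [|a| ^ p]; [l] is the derivative of
    [|.| ^ p] at [a]. Only the order of quantifiers matters later: [l] depends on [a] alone, so
    [l * b] integrates to zero when [b] is centred given [a]. *)
Lemma normD_powR_le p : 2 < p -> exists2 C : R, 0 < C &
  forall a, exists l : R, forall b,
    `|a + b| `^ p <=
    `|a| `^ p + l * b + C * (`|a| `^ (p - 2) * b ^+ 2 + `|b| `^ p).
Proof.
move=> p2; have p1 : 1 <= p by lra.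
set C := 2 * p ^+ 2 + (2 * p + 1) `^ p + (2 * p) `^ p.
have C1 : 1 <= C.
  have : 0 <= (2 * p + 1) `^ p by exact: powR_ge0.
  have : 0 <= (2 * p) `^ p by exact: powR_ge0.
  by rewrite /C; nra.
exists C; first lra.
move=> a; have [->|a0] := eqVneq a 0.
  exists 0 => b; rewrite add0r normr0 powR0 ?gt_eqF//; last lra.
  rewrite powR0 ?gt_eqF//; last lra.
  by rewrite !mul0r !add0r ler_peMl// powR_ge0.
have na0 : 0 < `|a| by rewrite normr_gt0.
exists (`|a| `^ p * p / a) => b.
have := norm1D_powR_le (b / a) p1; rewrite -/C => h.
have -> : a + b = a * (1 + b / a) by rewrite mulrDr mulr1 mulrCA divff// mulr1.
rewrite normrM powRM//.
have -> : `|a| `^ (p - 2) = `|a| `^ p / `|a| ^+ 2.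
  by rewrite powRB ?gt_eqF ?implybT// powR2// ltW.
have -> : `|b| `^ p = `|a| `^ p * `|b / a| `^ p.
  by rewrite -powRM// -normrM mulrCA divff// mulr1.
rewrite real_normK ?num_real//.
have P0 : 0 <= `|a| `^ p by exact: powR_ge0.
apply: (le_trans (ler_wpM2l P0 h)).
rewrite le_eqVlt; apply/orP; left; apply/eqP.
by field.
Qed.

(* The noise enters with weight [eta ^ (1 + p / 2)] rather than [eta ^ 2]:
   either [C b ^ 2 <= c / 2 * a ^ 2], and the cross term
   [C a ^ (p - 2) b ^ 2] is absorbed by the contraction, or [a] is itself of
   the order of [b]. *)
Lemma contraction_noise_le p c : 2 < p -> 0 < c -> exists2 K : R, 0 < K &
  forall eta a, 0 < eta <= 1 -> c * eta <= 1 -> exists l : R, forall z,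
    `|(1 - c * eta) * a - eta * z| `^ p <=
    (1 - c / 2 * eta) * `|a| `^ p + l * z + K * eta `^ (1 + p / 2) * `|z| `^ p.
Proof.
move=> p2 c0; have [C Cgt0 HC] := normD_powR_le p2.
have C0 := ltW Cgt0.
pose D := 2 * C / c.
have D0 : 0 <= D by rewrite /D; apply: divr_ge0; lra.
pose K1 := C * D `^ ((p - 2) / 2).
have K10 : 0 <= K1 by rewrite mulr_ge0// powR_ge0.
exists (K1 + C); first by rewrite ltr_wpDl.
move=> eta a /andP[eta0 eta1] ceta.
have [l Hl] := HC ((1 - c * eta) * a).
exists (- (l * eta)) => z; apply: (le_trans (Hl (- (eta * z)))).
have -> : l * - (eta * z) = - (l * eta) * z by ring.
have -> : - (eta * z) = - eta * z by ring.
have ce0 : 0 <= c * eta by rewrite mulr_ge0// ltW.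
have u1 : 0 <= 1 - c * eta <= 1 by lra.
set A := `|a| `^ p; set Z := `|z| `^ p.
have A0 : 0 <= A by exact: powR_ge0.
have Z0 : 0 <= Z by exact: powR_ge0.
have h1 : `|(1 - c * eta) * a| `^ p <= (1 - c * eta) * A.
  rewrite normrM powRM// ger0_norm; last lra.
  apply: ler_wpM2r => //.
  have [->|u0] := eqVneq (1 - c * eta) 0; first by rewrite powR0 ?gt_eqF//; lra.
  by apply: ge1r_powR; [rewrite lt_neqAle eq_sym u0; lra|lra].
have h2 : `|(1 - c * eta) * a| `^ (p - 2) <= `|a| `^ (p - 2).
  apply: le_powR => //; first lra.
  by rewrite normrM ger0_norm ?ler_piMl//; lra.
have eW : eta `^ (1 + p / 2) = eta * eta `^ (p / 2).
  by rewrite powRD_ge0 ?powRr1//; lra.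
have W0 : 0 <= eta `^ (p / 2) by exact: powR_ge0.
have h3 : `|- eta * z| `^ p <= eta `^ (1 + p / 2) * Z.
  rewrite mulNr normrN normrM powRM// (gtr0_norm eta0).
  by apply: ler_wpM2r => //; apply: ger_powR; [lra|lra].
(* The quadratic term contains [(eta * z) ^+ 2 = eta * (z ^+ 2 * eta)]. One factor [eta] is set
   aside until [h5]; the other stays with [z ^+ 2], so that its power [p / 2] is exactly
   [eta ^ (p / 2) |z| ^ p]. *)
have h4 : C * (`|a| `^ (p - 2) * z ^+ 2 * eta) <=
          c / 2 * A + K1 * (eta `^ (p / 2) * Z).
  have z2 : z ^+ 2 = `|z| ^+ 2 by rewrite real_normK// num_real.
  have eA : A = `|a| `^ (p - 2) * `|a| ^+ 2.
    by rewrite -powR2// -powRD_ge0//; [congr (_ `^ _)|]; lra.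
  have P0 : 0 <= `|a| `^ (p - 2) by exact: powR_ge0.
  have [le|/ltW ge] := leP (C * (z ^+ 2 * eta)) (c / 2 * `|a| ^+ 2).
    apply: (@le_trans _ _ (c / 2 * A)); last first.
      by rewrite lerDl mulr_ge0// mulr_ge0.
    rewrite eA (_ : C * _ = `|a| `^ (p - 2) * (C * (z ^+ 2 * eta))); last by ring.
    by rewrite (mulrCA (c / 2)) ler_wpM2l.
  have a2 : `|a| ^+ 2 <= D * (z ^+ 2 * eta).
    have c2 : 0 < c / 2 by lra.
    have eD : c / 2 * (D * (z ^+ 2 * eta)) = C * (z ^+ 2 * eta).
      by rewrite /D; field; rewrite gt_eqF.
    by rewrite -(ler_pM2l c2) eD.
  have pa : `|a| `^ (p - 2) <= D `^ ((p - 2) / 2) * (z ^+ 2 * eta) `^ ((p - 2) / 2).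
    have -> : `|a| `^ (p - 2) = (`|a| ^+ 2) `^ ((p - 2) / 2).
      by rewrite -powR2// -powRrM; congr (_ `^ _); field.
    have ze0 : 0 <= z ^+ 2 * eta by rewrite mulr_ge0 ?sqr_ge0// ltW.
    rewrite -powRM//.
    by apply: le_powR; rewrite ?sqr_ge0//; lra.
  have ze0 : 0 <= z ^+ 2 * eta by rewrite mulr_ge0 ?sqr_ge0// ltW.
  have eqZ : eta `^ (p / 2) * Z =
      (z ^+ 2 * eta) `^ ((p - 2) / 2) * (z ^+ 2 * eta).
    rewrite -{2}(powRr1 ze0) -powRD_ge0//; [|lra..].
    have -> : (p - 2) / 2 + 1 = p / 2 by field.
    rewrite powRM ?sqr_ge0//; last exact: ltW.
    rewrite mulrC z2 -powR2// -powRrM; congr (_ `^ _ * _); by field.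
  apply: (@le_trans _ _ (K1 * (eta `^ (p / 2) * Z))); last first.
    by rewrite lerDr mulr_ge0//; lra.
  rewrite eqZ /K1 -(mulrA (`|a| `^ _)).
  move: (z ^+ 2 * eta) ze0 pa => w w0 pa.
  by rewrite -mulrA; apply: ler_wpM2l => //; rewrite mulrA; exact: ler_wpM2r.
rewrite eW in h3 *.
have sq : (- eta * z) ^+ 2 = eta * (z ^+ 2 * eta) by ring.
have h5 : C * (`|(1 - c * eta) * a| `^ (p - 2) * (- eta * z) ^+ 2) <=
          eta * (c / 2 * A + K1 * (eta `^ (p / 2) * Z)).
  apply: (@le_trans _ _ (eta * (C * (`|a| `^ (p - 2) * z ^+ 2 * eta)))).
    have w0 : 0 <= z ^+ 2 * eta by rewrite mulr_ge0 ?sqr_ge0// ltW.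
    rewrite sq -(mulrA (`|a| `^ _)); move: (z ^+ 2 * eta) w0 => w w0.
    rewrite [leRHS]mulrCA (mulrCA eta).
    by rewrite ler_wpM2l// ler_wpM2r// mulr_ge0// ltW.
  by rewrite ler_wpM2l// ltW.
have h6 : C * `|- eta * z| `^ p <= C * (eta * eta `^ (p / 2) * Z).
  by rewrite ler_wpM2l.
by move: h1 h5 h6; rewrite mulrDr; lra.
Qed.

End power_inequalities.

(** * Norms and measurability on row vectors *)

Section norm_equivalence.
Context {R : realType} {d : nat}.
Variable nrm : 'rV[R]_d -> R.
Hypothesis nrmP : is_norm nrm.

Lemma is_norm0 : nrm 0 = 0.
Proof. by case: nrmP => _ nZ _; have := nZ 0 0; rewrite scale0r normr0 mul0r. Qed.

Lemma is_normN x : nrm (- x) = nrm x.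
Proof.
by case: nrmP => _ nZ _; rewrite -scaleN1r nZ normrN1 mul1r.
Qed.

Lemma is_normZ a x : nrm (a *: x) = `|a| * nrm x.
Proof. by case: nrmP. Qed.

Lemma is_norm_ge0 x : 0 <= nrm x.
Proof.
case: nrmP => _ _ nD; have := nD x (- x).
by rewrite subrr is_norm0 is_normN -mulr2n pmulrn_lge0.
Qed.

Lemma is_normD x y : nrm (x + y) <= nrm x + nrm y.
Proof. by case: nrmP. Qed.

Lemma is_norm_sum (I : Type) (r : seq I) (F : I -> 'rV[R]_d) :
  nrm (\sum_(i <- r) F i) <= \sum_(i <- r) nrm (F i).
Proof.
elim/big_ind2 : _ => [|x a y b xa yb|//]; first by rewrite is_norm0.
by apply: (le_trans (is_normD _ _)); exact: lerD.
Qed.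

Lemma coord_le_mx_norm (x : 'rV[R]_d) i : `|x 0 i| <= `|x|.
Proof.
rewrite /Num.norm/= mx_normrE.
exact: (le_bigmax 0 (fun ij : 'I_1 * 'I_d => `|x ij.1 ij.2|) (0, i)).
Qed.

Lemma is_norm_le_coord : exists2 K : R, 0 <= K &
  forall (x : 'rV[R]_d) M, (forall i, `|x 0 i| <= M) -> nrm x <= K * M.
Proof.
exists (\sum_i nrm (delta_mx 0 i)).
  by apply: sumr_ge0 => i _; exact: is_norm_ge0.
move=> x M xM; rewrite [x in leLHS]row_sum_delta.
apply: (le_trans (is_norm_sum _ _)); rewrite mulr_suml.
apply: ler_sum => i _; rewrite is_normZ mulrC.
by rewrite ler_wpM2l ?is_norm_ge0.
Qed.

Lemma is_norm_continuous : continuous nrm.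
Proof.
have [K K0 HK] := is_norm_le_coord.
have lip x y : nrm x - nrm y <= K * `|x - y|.
  apply: (@le_trans _ _ (nrm (x - y))); last first.
    by apply: HK => i; exact: coord_le_mx_norm.
  by rewrite lerBlDr -[x in leLHS](subrK y) is_normD.
move=> x; apply/(@cvgrPdist_le _ R^o _ _ (nbhs_filter x)) => e e0; apply/nbhs_ballP.
have K1 : 0 < K + 1 by rewrite ltr_wpDl.
exists (e / (K + 1)) => /=; first exact: divr_gt0.
move=> y; rewrite mx_norm_ball /ball_/= => /ltW xy.
have Kxy : K * `|x - y| <= e.
  rewrite -[leRHS](divfK (lt0r_neq0 K1)) mulrC; apply: ler_pM => //.
  by rewrite lerDl.
rewrite ler_norml; apply/andP; split; last exact: le_trans (lip x y) Kxy.
by rewrite lerNl opprB (le_trans (lip y x))// distrC.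
Qed.

(** By compactness, the continuous [nrm] has a positive minimum on the unit sphere of the sup norm,
    and [K] is its inverse. The sphere is empty when [d] is 0, whence the first case. *)
Lemma coord_le_is_norm : exists2 K : R, 0 <= K &
  forall (x : 'rV[R]_d) i, `|x 0 i| <= K * nrm x.
Proof.
pose S := [set x : 'rV[R]_d | `|x| = 1].
have [S0|/set0P/negP/negPn/eqP S0] := pselect (S !=set0); last first.
  exists 0 => // x i; rewrite mul0r; apply/(le_trans (coord_le_mx_norm _ _)).
  have [->|x0] := eqVneq x 0; first by rewrite normr0.
  suff : S (`|x|^-1 *: x) by rewrite S0.
  by rewrite /S/= mx_normZ normfV normr_id mulVf// normr_eq0.
have cS : compact S.
  apply: bounded_closed_compact.
    by exists 1; split => // y y1 x; rewrite /S/= => ->; exact: ltW.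
  rewrite (_ : S = Num.norm @^-1` [set x | x = 1])//.
  apply: closed_comp; last exact: closed_eq.
  by move=> x _; exact: norm_continuous.
have [|c cin cmin] := @EVT_min_rV R d nrm S S0 cS.
  by apply: continuous_subspaceT; exact: is_norm_continuous.
have c1 : `|c| = 1 by move: cin; rewrite inE.
have nc : 0 < nrm c.
  rewrite lt_neqAle is_norm_ge0 andbT eq_sym; apply/eqP => c0.
  case: nrmP => n0 _ _; move: c1; rewrite (n0 _ c0) normr0 => /eqP.
  by rewrite eq_sym oner_eq0.
exists (nrm c)^-1; first by rewrite invr_ge0 ltW.
move=> x i; apply: (le_trans (coord_le_mx_norm _ _)).
have [->|x0] := eqVneq x 0; first by rewrite normr0 is_norm0 mulr0.
have nx : 0 < `|x| by rewrite normr_gt0.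
have := cmin (`|x|^-1 *: x).
rewrite inE /S/= mx_normZ normfV normr_id mulVf ?gt_eqF// => /(_ erefl).
rewrite is_normZ normfV normr_id => h.
by move: h; rewrite !ler_pdivlMl// mulrC.
Qed.

End norm_equivalence.

Section vector_measurability.
Context {R : realType} {d : nat}.

(** The boxes with rational centre and radius [n.+1%:R^-1] form a countable base. Countability is
    what carries measurability from the coordinates to preimages of arbitrary open sets. *)
Lemma open_rational_box (U : set 'rV[R]_d) x : open U -> U x ->
  exists qn : 'rV[rat]_d * nat,
    (forall i, `|x 0 i - ratr (qn.1 0 i)| < qn.2.+1%:R^-1) /\
    (forall y : 'rV[R]_d, (forall i, `|y 0 i - ratr (qn.1 0 i)| < qn.2.+1%:R^-1) -> U y).
Proof.
move=> oU Ux; have /nbhs_ballP[e /= e0 xeU] := open_nbhs_nbhs (conj oU Ux).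
have [n _ ne] : exists2 n : nat, True & n.+1%:R^-1 < e / 2 :> R.
  have [n] := ltr_add_invr (divr_gt0 e0 (ltr0Sn R 1)); rewrite add0r => ?.
  by exists n.
have n0 : 0 < n.+1%:R^-1 :> R by rewrite invr_gt0.
have exq i : exists q : rat, ratr q \in `]x 0 i, (x 0 i + n.+1%:R^-1)[.
  by apply: rat_in_itvoo; rewrite ltrDl.
pose q i := xchoose (exq i).
have qP i : `|x 0 i - ratr (q i)| < n.+1%:R^-1.
  have := xchooseP (exq i); rewrite in_itv/= -/(q i) => /andP[q1 q2].
  move: (n.+1%:R^-1 : R) q1 q2 n0 => r q1 q2 r0.
  rewrite ltr_norml; apply/andP; split; lra.
exists (\row_i q i, n); split => /=; first by move=> i; rewrite mxE.
move=> y yq; apply: xeU; split => // a i; rewrite ord1 /ball/=.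
have := yq i; rewrite mxE => yqi; have xqi := qP i.
move: (n.+1%:R^-1 : R) ne yqi xqi => r re.
by rewrite !ltr_norml => /andP[? ?] /andP[? ?]; apply/andP; split; lra.
Qed.

Lemma measurable_rV_open dT (T : measurableType dT) (X : T -> 'rV[R]_d)
  (U : set 'rV[R]_d) :
  (forall i, measurable_fun setT (fun w => X w 0 i)) -> open U ->
  measurable (X @^-1` U).
Proof.
move=> mX oU.
pose box (qn : 'rV[rat]_d * nat) : set 'rV[R]_d :=
  [set y | forall i, `|y 0 i - ratr (qn.1 0 i)| < qn.2.+1%:R^-1].
have -> : X @^-1` U =
    \bigcup_(qn : 'rV[rat]_d * nat)
      (if `[< box qn `<=` U >] then X @^-1` box qn else set0).
  apply/seteqP; split => w /=.
    move=> /(open_rational_box oU)[qn [wqn qnU]]; exists qn => //.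
    by rewrite asboolT.
  by move=> [qn _]; case: asboolP => // qnU; exact: qnU.
apply: countable_bigcupT_measurable; first exact: countableP.
move=> qn; case: asboolP => // _.
rewrite (_ : X @^-1` box qn =
    \bigcap_(i in [set: 'I_d])
      ((fun w => `|X w 0 i - ratr (qn.1 0 i)|) @^-1` `]-oo, qn.2.+1%:R^-1[)).
  apply: fin_bigcap_measurable; first exact: finite_finset.
  move=> i _; rewrite -[X in measurable X]setTI.
  suff : measurable_fun setT (fun w => `|X w 0 i - ratr (qn.1 0 i)|) by apply.
  apply: measurableT_comp => //; apply: measurable_funB => //.
apply/seteqP; split => w /=; rewrite /box/=.
  by move=> h i _; rewrite /= in_itv/=.
by move=> h i; have := h i I; rewrite /= in_itv/=.
Qed.

Lemma measurable_nrm dT (T : measurableType dT) (nrm : 'rV[R]_d -> R)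
  (X : T -> 'rV[R]_d) : is_norm nrm ->
  (forall i, measurable_fun setT (fun w => X w 0 i)) ->
  measurable_fun setT (fun w => nrm (X w)).
Proof.
move=> nrmP mX.
apply: (measurability _ (RGenOInfty.measurableE R)) => _ [_ [y ->] <-].
rewrite setTI (_ : _ @^-1` _ = X @^-1` (nrm @^-1` [set x | y < x])).
  apply: measurable_rV_open => //; apply: open_comp; last exact: open_gt.
  by move=> x _; exact: is_norm_continuous.
by apply/seteqP; split => w /=; rewrite in_itv/= andbT.
Qed.

(** The sets with measurable preimage under [(X, Y)] form a sigma-algebra containing the rectangles
    that generate the one in [jointly_measurable]. *)
Lemma measurable_jointly dT (T : measurableType dT) dX
  (Xi : measurableType dX) (H : 'rV[R]_d -> Xi -> 'rV[R]_d)
  (X : T -> 'rV[R]_d) (Y : T -> Xi) i :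
  jointly_measurable H ->
  (forall i, measurable_fun setT (fun w => X w 0 i)) ->
  measurable_fun setT Y ->
  measurable_fun setT (fun w => H (X w) (Y w) 0 i).
Proof.
move=> mH mX mY _ B mB; rewrite setTI.
suff rect E : <<s @prod_rect_sets R d dX Xi >> E ->
    measurable ((fun w => (X w, Y w)) @^-1` E) by exact: rect (mH i B mB).
move: E; apply: smallest_sub; first split.
- by rewrite /= preimage_set0.
- by move=> E mE /=; rewrite setTD -preimage_setC; exact: measurableC.
- by move=> E mE /=; rewrite preimage_bigcup; exact: bigcup_measurable.
move=> _ [U oU [A mA <-]] /=.
rewrite (_ : _ @^-1` _ = X @^-1` U `&` Y @^-1` A); last first.
  by apply/seteqP; split => w.
apply: measurableI; first exact: measurable_rV_open.
by rewrite -[X in measurable X]setTI; exact: mY.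
Qed.

End vector_measurability.

(** * Kernels and the Markov property *)

Section kernel_precomposition.
Context d0 d1 d2 (X : measurableType d0) (Y : measurableType d1)
  (Z : measurableType d2) (R : realType).
Variables (k : R.-pker Y ~> Z) (f : X -> Y).

(** The measurability proof [mf] is part of the term so that the kernel structure can be inferred
    from it. *)
Definition kprecomp (mf : measurable_fun setT f) (x : X) :
  {measure set Z -> \bar R} := k (f x).

Hypothesis mf : measurable_fun setT f.

Let measurable_kprecomp U : measurable U ->
  measurable_fun setT (kprecomp mf ^~ U).
Proof. by move=> mU; exact: measurableT_comp (measurable_kernel k U mU) mf. Qed.

HB.instance Definition _ := isKernel.Build _ _ _ _ _ (kprecomp mf)
  measurable_kprecomp.

Let kprecomp_prob x : kprecomp mf x setT = 1%E.
Proof. exact: prob_kernel. Qed.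

HB.instance Definition _ := Kernel_isProbability.Build _ _ _ _ _
  (kprecomp mf) kprecomp_prob.

End kernel_precomposition.

Arguments kprecomp {d0 d1 d2 X Y Z R} k {f} mf.

Lemma measurable_integral_kprecomp d0 d1 d2 (X : measurableType d0)
  (Y : measurableType d1) (Z : measurableType d2) (R : realType)
  (k : R.-pker Y ~> Z) (f : X -> Y) (g : X * Z -> \bar R) :
  measurable_fun setT f -> measurable_fun setT g -> (forall xz, 0 <= g xz)%E ->
  measurable_fun setT (fun x => \int[k (f x)]_z g (x, z))%E.
Proof.
move=> mf mg g0.
pose l : R.-fker X ~> Z := kprecomp k mf.
exact: (measurable_fun_integral_finite_kernel g l).
Qed.

(** A probability is a kernel out of the one-point space, which turns the claim into the integration
    formula for composed kernels. *)
Lemma integral_mixture d1 d2 (Y : measurableType d1) (Z : measurableType d2)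
  (R : realType) (mu : probability Y R) (k : R.-pker Y ~> Z)
  (nu : {measure set Z -> \bar R}) (f : Z -> \bar R) :
  (forall A, measurable A -> nu A = \int[mu]_y k y A)%E ->
  (forall z, 0 <= f z)%E -> measurable_fun setT f ->
  (\int[nu]_z f z = \int[mu]_y \int[k y]_z f z)%E.
Proof.
move=> nuE f0 mf.
pose l : R.-sfker unit ~> Y :=
  kprobability (measurable_cst (mu : pprobability Y R)).
pose k' : R.-sfker (unit * Y) ~> Z := kprecomp k (@measurable_snd _ _ unit Y).
rewrite -[RHS](@integral_kcomp _ _ _ _ _ _ _ l k' tt)//.
by apply: eq_measure_integral => A mA _; exact: nuE.
Qed.

(** These are the past events over which [markov_chain] integrates. They are stable under
    intersection, hence determine a finite measure on the sigma-algebra they generate. *)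
Definition cylinders (dX : measure_display) (Xi : measurableType dX)
  (Omega : Type) (xi : nat -> Omega -> Xi) (t : nat) : set (set Omega) :=
  [set C | exists2 A : nat -> set Xi, (forall s, measurable (A s)) &
           C = [set w | forall s, (s <= t)%N -> A s (xi s w)]].

Section history.
Context (R : realType) (dX : measure_display) (Xi : measurableType dX)
  (dO : measure_display) (Omega : measurableType dO).
Variable xi : nat -> Omega -> Xi.
Hypothesis mxi : forall t, measurable_fun setT (xi t).

(* [Omega] itself, equipped with the sigma-algebra generated by xi 0, ..., xi t:
   being adapted is measurability out of this type. *)
Definition history (t : nat) := g_sigma_algebraType (cylinders xi t).

Lemma cylindersT t : cylinders xi t setT.
Proof. by exists (fun=> setT) => //; apply/seteqP; split. Qed.

Lemma cylindersI t : setI_closed (cylinders xi t).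
Proof.
move=> _ _ [A mA ->] [B mB ->]; exists (fun s => A s `&` B s).
  by move=> s; exact: measurableI.
apply/seteqP; split => w /=; first by move=> [wA wB] s st; split; auto.
by move=> wAB; split => s /wAB[].
Qed.

Lemma measurable_cylinders t C : cylinders xi t C -> measurable C.
Proof.
move=> [A mA ->].
rewrite [X in measurable X](_ : _ =
    \bigcap_(s in [set s | (s <= t)%N]) (xi s @^-1` A s)); last first.
  by apply/seteqP; split => w.
apply: bigcap_measurable; first by exists 0%N.
by move=> s _; rewrite -[X in measurable X]setTI; exact: mxi.
Qed.

(** Inclusion of sigma-algebras is expressed as measurability of the identity into the coarser type;
    [historyS] does the same for two successive histories. *)
Lemma measurable_history t :
  measurable_fun setT (fun w : Omega => w : history t).
Proof.
move=> _ B mB; rewrite setTI; move: B mB.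
apply: smallest_sub; first exact: sigma_algebra_measurable.
by move=> C; exact: measurable_cylinders.
Qed.

Lemma history_measurable_xi t s : (s <= t)%N ->
  measurable_fun setT (xi s : history t -> Xi).
Proof.
move=> st _ B mB; rewrite setTI; apply: sub_sigma_algebra.
exists (fun r => if r == s then B else setT); first by move=> r; case: ifP.
apply/seteqP; split => w /=.
  by move=> wB r _; case: eqP => // ->.
by move=> /(_ s st); rewrite eqxx.
Qed.

Lemma historyS t : measurable_fun setT (fun w : history t.+1 => w : history t).
Proof.
move=> _ B mB; rewrite setTI; move: B mB.
apply: smallest_sub; first exact: sigma_algebra_measurable.
move=> _ [A mA ->]; apply: sub_sigma_algebra.
exists (fun r => if (r <= t)%N then A r else setT).
  by move=> r; case: ifP.
apply/seteqP; split => w /=.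
  by move=> wA r _; case: ifP => // /wA.
by move=> wA r rt; have := wA r (leqW rt); rewrite rt.
Qed.

End history.
Arguments measurable_history {dX Xi dO Omega xi} mxi t.

(** The Markov property is given on cylinders only, so the product sigma-algebra needs a generating
    family of rectangles whose first side is a cylinder. *)
Lemma measurable_history_prod dX (Xi : measurableType dX) dO
  (Omega : measurableType dO) (xi : nat -> Omega -> Xi) t :
  @measurable _ (history xi t * Xi)%type =
  <<s [set A `*` B | A in cylinders xi t & B in measurable] >>.
Proof.
rewrite eqEsubset; split; last first.
  apply: smallest_sub; first exact: smallest_sigma_algebra.
  move=> _ [A cA [B mB <-]].
  by apply: measurableX => //; exact: sub_sigma_algebra.
apply: smallest_sub; first exact: smallest_sigma_algebra.
rewrite subUset; split.
  rewrite -[X in preimage_set_system _ _ X]/(<<s cylinders xi t>>).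
  rewrite -g_sigma_preimageE; apply: sub_smallest2r.
    exact: smallest_sigma_algebra.
  move=> _ [A cA <-]; exists A => //; exists setT; first by [].
  by rewrite setTI; apply/seteqP; split => ab /=; tauto.
move=> _ [B mB <-]; apply: sub_sigma_algebra; exists setT; first exact: cylindersT.
by exists B => //; rewrite setTI; apply/seteqP; split => ab /=; tauto.
Qed.

(** Conditioning on the whole past for a function of both the past and the next state. Both sides
    are integrals of [f] against measures on [history xi t * Xi], which agree on the generating
    rectangles by [markov_chain]. *)
Lemma markov_integral (R : realType) dX (Xi : measurableType dX) dO
  (Omega : measurableType dO) (Pr : probability Omega R)
  (k : R.-pker Xi ~> Xi) (xi : nat -> Omega -> Xi) t
  (f : history xi t * Xi -> \bar R) :
  markov_chain Pr k xi -> (forall z, 0 <= f z)%E -> measurable_fun setT f ->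
  (\int[Pr]_w f (w, xi t.+1 w) = \int[Pr]_w \int[k (xi t w)]_z f (w, z))%E.
Proof.
move=> [mxi markov] f0 mf.
have mp : measurable_fun setT
    (fun w : Omega => (w : history xi t, xi t.+1 w) : history xi t * Xi).
  by apply: measurable_fun_pair; [exact: measurable_history|exact: mxi].
pose l : R.-sfker unit ~> Omega :=
  kprobability (measurable_cst (Pr : pprobability Omega R)).
have mxit : measurable_fun setT (fun uw : unit * Omega => xi t uw.2).
  exact: measurableT_comp (mxi t) measurable_snd.
have mswap : measurable_fun setT
    (fun uwz : (unit * Omega) * Xi =>
      (uwz.1.2 : history xi t, uwz.2) : history xi t * Xi).
  apply: measurable_fun_pair; last exact: measurable_snd.
  have m12 : measurable_fun setT (fun uwz : (unit * Omega) * Xi => uwz.1.2).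
    exact: measurableT_comp measurable_snd measurable_fst.
  exact: measurableT_comp (measurable_history mxi t) m12.
(* [k1] draws the next state and [k2] pairs it with the past, so [kk] is the law of [(w, z)] with
   [z] drawn from [k (xi t w)]. *)
pose k1 : R.-sfker (unit * Omega) ~> Xi := kprecomp k mxit.
pose k2 : R.-sfker ((unit * Omega) * Xi) ~> (history xi t * Xi)%type :=
  kdirac mswap.
pose kk : R.-sfker (unit * Omega) ~> (history xi t * Xi)%type := mkcomp k1 k2.
have kkE (g : history xi t * Xi -> \bar R) w : (forall z, 0 <= g z)%E ->
    measurable_fun setT g ->
    (\int[kk (tt, w)]_z g z = \int[k (xi t w)]_z g (w, z))%E.
  move=> g0 mg; rewrite (@integral_kcomp _ _ _ _ _ _ _ k1 k2 (tt, w))//.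
  apply: eq_integral => z _; rewrite integral_dirac ?diracT ?mul1e//.
rewrite -[RHS](eq_integral _ _ (fun w _ => kkE f w f0 mf)).
rewrite -(@integral_kcomp _ _ _ _ _ _ _ l kk tt f f0 mf).
pose e (w : Omega) : history xi t * Xi := (w, xi t.+1 w).
have -> : (\int[Pr]_w f (w, xi t.+1 w) = \int[pushforward Pr e]_z f z)%E.
  by rewrite ge0_integral_pushforward// preimage_setT.
apply: eq_measure_integral => /= E mE _.

apply: (@measure_unique _ _ _ _ (fun=> setT) (measurable_history_prod xi t)) => //.
- move=> _ _ [A cA [B mB <-]] [A' cA' [B' mB' <-]]; rewrite -setXI.
  exists (A `&` A'); first exact: cylindersI.
  by exists (B `&` B') => //; exact: measurableI.
- by move=> _; exists setT; [exact: cylindersT|exists setT => //; exact: setXTT].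
- by apply/seteqP; split => // x _; exists 0%N.
- move=> _ [C cC [B mB <-]].
  have mC := measurable_cylinders mxi cC.
  have mCB : measurable (C `*` B : set (history xi t * Xi)).
    by apply: measurableX => //; exact: sub_sigma_algebra.
  transitivity (Pr (C `&` xi t.+1 @^-1` B)); first by [].
  have -> : Pr (C `&` xi t.+1 @^-1` B) = (\int[Pr]_(w in C) k (xi t w) B)%E.
    by case: cC => A mA ->; exact: markov.
  rewrite integral_mkcond/=; apply: eq_integral => w _.
  have := kkE (fun z => (\1_(C `*` B) z)%:E) w.
  rewrite integral_indic// setIT => kkCB; rewrite kkCB; first last.
  - by apply/measurable_EFinP; exact: measurable_indic.
  - by move=> z; rewrite lee_fin.
  rewrite patchE; case: ifPn => wC.
    transitivity (\int[k (xi t w)]_z (\1_B z)%:E)%E.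
      by rewrite integral_indic// setIT.
    apply: eq_integral => z _; congr EFin; rewrite !indicE in_setX wC//.
  by rewrite integral0_eq// => z _; rewrite indicE in_setX (negbTE wC).
- move=> _; rewrite /= /pushforward preimage_setT probability_setT.
  exact: ltry.
Qed.

(** * The Poisson equation *)

Section bounded_measurable.
Context {R : realType} {dX : measure_display} {Xi : measurableType dX}.
Implicit Types (f g : Xi -> R) (B : R) (mu : {measure set Xi -> \bar R}).

Definition bmeasurable f B := measurable_fun setT f /\ forall x, `|f x| <= B.

Lemma bmeasurableD f g Bf Bg : bmeasurable f Bf -> bmeasurable g Bg ->
  bmeasurable (fun x => f x + g x) (Bf + Bg).
Proof.
move=> [mf fB] [mg gB]; split; first exact: measurable_funD.
by move=> x; apply: (le_trans (ler_normD _ _)); exact: lerD.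
Qed.

Lemma bmeasurableZ a f B : bmeasurable f B ->
  bmeasurable (fun x => a * f x) (`|a| * B).
Proof.
move=> [mf fB]; split; first exact: measurable_funM.
by move=> x; rewrite normrM ler_wpM2l.
Qed.

Lemma bmeasurable_indic (A : set Xi) : measurable A ->
  bmeasurable (\1_A) 1.
Proof.
by move=> mA; split => // x; rewrite indicE; case: (_ \in _); rewrite ?normr1 ?normr0.
Qed.

Lemma bmeasurable_integrable mu f B : mu setT = 1%E -> bmeasurable f B ->
  mu.-integrable setT (EFin \o f).
Proof.
move=> mu1 [mf fB].
apply: measurable_bounded_integrable; rewrite ?mu1 ?ltry//.
exists B; split; first exact: num_real.
by move=> y By x _; exact: le_trans (ltW By).
Qed.

Lemma Rintegral_bmeasurable_le mu f B : mu setT = 1%E -> bmeasurable f B ->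
  `|Rintegral mu setT f| <= B.
Proof.
move=> mu1 fB; have fi := bmeasurable_integrable mu1 fB.
apply: (le_trans (le_normr_Rintegral measurableT fi)).
rewrite -[leRHS]mulr1 -[X in _ * X]/(fine 1%E).
rewrite -mu1 -Rintegral_cst//.
apply: le_Rintegral => //.
- exact: integrable_norm.
- by apply: (@bmeasurable_integrable _ _ `|B| mu1); split.
- by move=> x _; case: fB.
Qed.

Lemma Rintegral1 mu : mu setT = 1%E -> Rintegral mu setT (fun=> 1) = 1.
Proof. by move=> mu1; rewrite Rintegral_cst// mu1 mulr1. Qed.

(** On [[0, N]] the sum counts the positive integers up to [x], so it is the integer part of [x]. *)
Lemma indicator_sum_approx (N : nat) (x : R) : 0 <= x <= N%:R ->
  `|x - \sum_(m < N) (m.+1%:R <= x)%R%:R| <= 1.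
Proof.
move=> xN; suff : x - 1 <= \sum_(m < N) (m.+1%:R <= x)%R%:R <= x.
  by rewrite ler_norml => /andP[? ?]; apply/andP; split; lra.
elim: N xN => [|N IHN] /andP[x0 xN]; first by rewrite big_ord0; lra.
rewrite big_ord_recr/=; have [xleN|Nltx] := leP x N%:R.
  have /IHN : 0 <= x <= N%:R by rewrite x0.
  suff /negbTE -> : ~~ (N.+1%:R <= x) by rewrite addr0.
  by rewrite -ltNge (le_lt_trans xleN)// ltr_nat.
rewrite (eq_bigr (fun=> 1)) => [|m _]; last first.
  by rewrite (_ : _ <= _)// (le_trans _ (ltW Nltx))// ler_nat.
rewrite sumr_const card_ord -natr1 in xN *.
by case: (boolP (N%:R + 1 <= x)) => Nx /=; apply/andP; split; lra.
Qed.

(* Layer cake: [f] is uniformly close to a multiple of a sum of indicators of its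
   superlevel sets, plus a constant. *)
Lemma bounded_functional_le (L : (Xi -> R) -> R) (delta : R) f B :
  (forall f g Bf Bg, bmeasurable f Bf -> bmeasurable g Bg ->
     L (fun x => f x + g x) = L f + L g) ->
  (forall a f B, bmeasurable f B -> L (fun x => a * f x) = a * L f) ->
  (forall f B, bmeasurable f B -> `|L f| <= 2 * B) ->
  L (fun=> 1) = 0 ->
  (forall A, measurable A -> `|L (\1_A)| <= delta) ->
  0 <= B -> bmeasurable f B -> `|L f| <= 2 * B * delta.
Proof.
move=> LD LZ LB L1 Lind B0 fB.
have [Beq0|Bneq0] := eqVneq B 0.
  by have := LB _ _ fB; rewrite Beq0 mulr0 mul0r.
have Bgt0 : 0 < B by rewrite lt_neqAle eq_sym Bneq0.
have m1 : bmeasurable (fun=> 1) 1 by split => // x; rewrite normr1.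
suff appr (N : nat) : `|L f| <= 4 * B * N.+1%:R^-1 + 2 * B * delta.
  rewrite leNgt; apply/negP => h.
  have B4 : 0 < 4 * B by lra.
  have : 0 < (`|L f| - 2 * B * delta) / (4 * B).
    by rewrite divr_gt0// subr_gt0.
  move=> /ltr_add_invr[N]; rewrite add0r ltr_pdivlMr//.
  by have := appr N; move: (N.+1%:R^-1) => r; lra.
(* [x] maps the range [[-B, B]] of [f] affinely onto [[0, N.+1]]. Undoing this multiplies by
   [c = 2 B / N.+1]: the rounding error 1 becomes [c], which vanishes for large [N], and the [N.+1]
   indicators contribute [c * N.+1 * delta = 2 * B * delta] whatever [N] is. *)
pose x y : R := (f y + B) * (N.+1%:R / (2 * B)).
pose S n y : R := \sum_(m < n) (m.+1%:R <= x y)%R%:R.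
have N0 : 0 < N.+1%:R :> R by rewrite ltr0n.
have [mf fle] := fB.
have mx : measurable_fun setT x.
  by apply: measurable_funM => //; exact: measurable_funD.
have x0N y : 0 <= x y <= N.+1%:R.
  have := fle y; rewrite ler_norml => /andP[fl fu].
  apply/andP; split; first by rewrite mulr_ge0//; [lra|rewrite divr_ge0//; lra].
  rewrite /x mulrA ler_pdivrMr; last lra.
  by rewrite mulrC ler_pM2l//; lra.
have mA (m : nat) : measurable (x @^-1` `[m.+1%:R, +oo[).
  by rewrite -[X in measurable X]setTI; exact: mx.
have indE (m : nat) y : (m.+1%:R <= x y)%R%:R = \1_(x @^-1` `[m.+1%:R, +oo[) y :> R.
  rewrite indicE; congr ((nat_of_bool _)%:R).
  by apply/idP/idP; rewrite inE/= in_itv/= andbT.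
have SS n : S n.+1 = fun y => S n y + \1_(x @^-1` `[n.+1%:R, +oo[) y.
  by apply/funext => y; rewrite /S big_ord_recr/= indE.
have bS n : bmeasurable (S n) n%:R.
  elim: n => [|n IHn].
    have -> : S 0%N = cst 0 by apply/funext => y; rewrite /S big_ord0.
    by split => // y; rewrite normr0.
  rewrite SS -[X in bmeasurable _ X]natr1.
  exact: bmeasurableD IHn (bmeasurable_indic (mA n)).
have LS n : `|L (S n)| <= n%:R * delta.
  elim: n => [|n IHn].
    have -> : S 0%N = fun y => 0 * S 0%N y.
      by apply/funext => y; rewrite /S big_ord0 mul0r.
    by rewrite (LZ _ _ _ (bS 0%N)) !mul0r normr0.
  rewrite SS (LD _ _ _ _ (bS n) (bmeasurable_indic (mA n))) -[X in X * _]natr1.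
  by rewrite (le_trans (ler_normD _ _))// mulrDl mul1r lerD// Lind.
pose c := 2 * B / N.+1%:R.
have c0 : 0 < c by rewrite divr_gt0//; lra.
pose h y := c * (x y - S N.+1 y).
have bh : bmeasurable h c.
  split.
    apply: measurable_funM => //; apply: measurable_funB => //.
    exact: (bS _).1.
  move=> y; rewrite normrM gtr0_norm// ler_piMr ?(ltW c0)//.
  exact: indicator_sum_approx.
have fE : f = fun y => h y + (c * S N.+1 y + - B * 1).
  apply/funext => y; rewrite /h /c /x; move: (S N.+1 y) => s.
  move: (N.+1%:R : R) (lt0r_neq0 N0) => n n0; field.
  by rewrite Bneq0 n0.
have bcS := bmeasurableZ c (bS N.+1).
have bB := bmeasurableZ (- B) m1.
have bcSB := bmeasurableD bcS bB.
rewrite fE (LD _ _ _ _ bh bcSB) (LD _ _ _ _ bcS bB).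
rewrite (LZ c _ _ (bS N.+1)) (LZ _ _ _ m1) L1 mulr0 addr0.
apply: (le_trans (ler_normD _ _)); apply: lerD.
  by apply: (le_trans (LB _ _ bh)); rewrite /c; move: (N.+1%:R^-1) => r; lra.
rewrite normrM gtr0_norm//; apply: (@le_trans _ _ (c * (N.+1%:R * delta))).
  by rewrite ler_wpM2l// ltW.
by rewrite mulrA /c divfK// gt_eqF.
Qed.

End bounded_measurable.

Lemma measurable_Rintegral_kprecomp d0 d1 d2 (X : measurableType d0)
  (Y : measurableType d1) (Z : measurableType d2) (R : realType)
  (k : R.-pker Y ~> Z) (f : X -> Y) (g : X * Z -> R) :
  measurable_fun setT f -> measurable_fun setT g ->
  measurable_fun setT (fun x => Rintegral (k (f x)) setT (fun z => g (x, z))).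
Proof.
move=> mf mg.
have mEg : measurable_fun setT (EFin \o g) by exact/measurable_EFinP.
rewrite /Rintegral; apply: measurableT_comp => //.
have -> : (fun x => \int[k (f x)]_z (g (x, z))%:E)%E =
    (fun x => \int[k (f x)]_z (EFin \o g)^\+ (x, z) -
              \int[k (f x)]_z (EFin \o g)^\- (x, z))%E.
  apply/funext => x; rewrite integralE.
  by congr (_ - _)%E; apply: eq_integral => z _; rewrite !(funeposE, funenegE).
apply: emeasurable_funB.
  apply: measurable_integral_kprecomp => //; exact: measurable_funepos.
apply: measurable_integral_kprecomp => //; exact: measurable_funeneg.
Qed.

Section kernel_operator.
Context {R : realType} {dX : measure_display} {Xi : measurableType dX}.
Variable k : R.-pker Xi ~> Xi.
Implicit Types (f g : Xi -> R) (B : R).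

Definition kop f (y : Xi) : R := Rintegral (k y) setT f.

Lemma measurable_kop f : measurable_fun setT f -> measurable_fun setT (kop f).
Proof.
move=> mf; rewrite /kop.
apply: (@measurable_Rintegral_kprecomp _ _ _ _ _ _ _ k id (f \o snd)) => //.
exact: measurableT_comp mf measurable_snd.
Qed.

Lemma kop_bmeasurable f B : bmeasurable f B -> bmeasurable (kop f) B.
Proof.
move=> fB; split; first by apply: measurable_kop; case: fB.
move=> y; exact: Rintegral_bmeasurable_le (prob_kernel y) fB.
Qed.

Lemma kopD f g Bf Bg : bmeasurable f Bf -> bmeasurable g Bg ->
  kop (fun x => f x + g x) = fun x => kop f x + kop g x.
Proof.
move=> fB gB; apply/funext => y; rewrite /kop RintegralD//.
- exact: bmeasurable_integrable (prob_kernel y) fB.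
- exact: bmeasurable_integrable (prob_kernel y) gB.
Qed.

Lemma kopZ a f B : bmeasurable f B ->
  kop (fun x => a * f x) = fun x => a * kop f x.
Proof.
move=> fB; apply/funext => y; rewrite /kop RintegralZl//.
exact: bmeasurable_integrable (prob_kernel y) fB.
Qed.

Lemma kop1 : kop (fun=> 1) = fun=> 1.
Proof.
by apply/funext => y; exact: Rintegral1 (prob_kernel y).
Qed.

Lemma iter_kop_bmeasurable j f B : bmeasurable f B ->
  bmeasurable (iter j kop f) B.
Proof. by move=> fB; elim: j => // j IHj /=; exact: kop_bmeasurable. Qed.

Lemma iter_kopD j f g Bf Bg : bmeasurable f Bf -> bmeasurable g Bg ->
  iter j kop (fun x => f x + g x) = fun x => iter j kop f x + iter j kop g x.
Proof.
move=> fB gB; elim: j => // j IHj; rewrite !iterS IHj.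
by apply: kopD; apply: iter_kop_bmeasurable; [exact: fB|exact: gB].
Qed.

Lemma iter_kopZ j a f B : bmeasurable f B ->
  iter j kop (fun x => a * f x) = fun x => a * iter j kop f x.
Proof.
move=> fB; elim: j => // j IHj; rewrite !iterS IHj.
by apply: kopZ; apply: iter_kop_bmeasurable; exact: fB.
Qed.

Lemma iter_kop1 j : iter j kop (fun=> 1) = fun=> 1.
Proof. by elim: j => // j IHj; rewrite iterS IHj kop1. Qed.

(** [Piter] is a set function and the mixing assumption speaks of sets; this links it to the
    operator iterates, which act on functions. *)
Lemma PiterE j y (A : set Xi) : measurable A ->
  Piter k j y A = (iter j kop (\1_A) y)%:E.
Proof.
move=> mA; elim: j y => [|j IHj] y /=; first by rewrite diracE indicE.
under eq_integral do rewrite IHj.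
have bA := iter_kop_bmeasurable j (bmeasurable_indic mA).
rewrite /kop /Rintegral fineK//; apply: integrable_fin_num => //.
exact: bmeasurable_integrable (prob_kernel y) bA.
Qed.

Section mixing.
Variables (mu : probability Xi R) (kappa rho : R).
Hypothesis rho01 : 0 <= rho < 1.
Hypothesis mixing :
  forall y t, (dTV (Piter k t y) mu <= (kappa * rho ^+ t / 2)%:E)%E.

(** Apply [bounded_functional_le] to the difference of the two expectations with
    [delta = kappa * rho ^+ j / 2]; the factor 2 there cancels the division by 2 in the mixing
    bound. *)
Lemma iter_kop_mixing j f B y : 0 <= B -> bmeasurable f B ->
  `|iter j kop f y - Rintegral mu setT f| <= B * kappa * rho ^+ j.
Proof.
move=> B0 fB; have mu1 := @probability_setT _ _ _ mu.
pose L g := iter j kop g y - Rintegral mu setT g.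
have -> : B * kappa * rho ^+ j = 2 * B * (kappa * rho ^+ j / 2) by field.
apply: (@bounded_functional_le _ _ _ L) => //.
- move=> g h Bg Bh gB hB; rewrite /L (iter_kopD _ gB hB) RintegralD//.
  + by ring.
  + exact: bmeasurable_integrable mu1 gB.
  + exact: bmeasurable_integrable mu1 hB.
- move=> a g Bg gB; rewrite /L (iter_kopZ _ _ gB) RintegralZl//.
  + by ring.
  + exact: bmeasurable_integrable mu1 gB.
- move=> g Bg gB; apply: (le_trans (ler_normB _ _)).
  rewrite mulr_natl mulr2n lerD//; last exact: Rintegral_bmeasurable_le mu1 gB.
  by case: (iter_kop_bmeasurable j gB).
- rewrite /L iter_kop1; apply/eqP; rewrite subr_eq0 eq_sym; apply/eqP.
  exact: Rintegral1.
move=> A mA; have := mixing y j.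
rewrite -lee_fin; apply: le_trans; apply: ereal_sup_ubound.
exists A => //; rewrite PiterE// /L /Rintegral integral_indic// setIT.
have muA : mu A \is a fin_num by rewrite fin_num_measure.
by rewrite -{1}(fineK muA) -EFinB abse_EFin.
Qed.

(** Since [f] has mean zero, mixing bounds the terms [F j] themselves. The partial sums satisfy
    [S n.+1 = f + kop (S n)], and their uniform error of order [rho ^+ n] passes through [kop], so
    the identity survives in the limit. *)
Lemma poisson_equation f B : 0 <= B -> bmeasurable f B ->
  Rintegral mu setT f = 0 ->
  exists U, (exists BU, bmeasurable U BU) /\ (forall y, U y = f y + kop U y).
Proof.
move=> B0 fB f0; have [rho0 rho1] := andP rho01.
have nrho : `|rho| < 1 by rewrite ger0_norm.
(* At time 0 the total variation distance, being nonnegative, is bounded by [kappa / 2]. *)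
have kappa0 : 0 <= kappa.
  have := mixing point 0; rewrite expr0 mulr1 => h.
  have : (0 <= (kappa / 2)%:E)%E.
    apply: (le_trans _ h).
    apply: (le_trans (abse_ge0 (Piter k 0 point setT - mu setT)%E)).
    by apply: ereal_sup_ubound; exists setT => //; exact: measurableT.
  by rewrite lee_fin; lra.
pose C := B * kappa; have C0 : 0 <= C by rewrite mulr_ge0.
pose F j y := iter j kop f y.
have FC j y : `|F j y| <= C * rho ^+ j.
  by have := iter_kop_mixing j y B0 fB; rewrite f0 subr0.
have Fb j : bmeasurable (F j) B by exact: iter_kop_bmeasurable.
pose S n y := series (F ^~ y) n.
pose K := C / (1 - rho).
have r1 : 0 < 1 - rho by lra.
have K0 : 0 <= K by rewrite divr_ge0// ltW.
have tail m n y : `|S (n + m)%N y - S n y| <= K * rho ^+ n.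
  (* The subtracted term makes the induction on [m] telescope: each new term is [C * rho ^+ j = K *
     rho ^+ j - K * rho ^+ j.+1]. *)
  suff : `|S (n + m)%N y - S n y| <= K * rho ^+ n - K * rho ^+ (n + m)%N.
    by move=> /le_trans; apply; rewrite gerBl mulr_ge0// exprn_ge0.
  elim: m => [|m IHm]; first by rewrite addn0 !subrr normr0.
  rewrite addnS /S seriesSr -/(S _ _) addrAC.
  apply: (le_trans (ler_normD _ _)); apply: (le_trans (lerD IHm (FC _ _))).
  rewrite exprS; move: (rho ^+ (n + m)%N) (rho ^+ n) => a b.
  have -> : C = K * (1 - rho) by rewrite /K divfK// gt_eqF.
  by lra.
have cvgS y : cvgn (S ^~ y).
  rewrite /S; apply: normed_cvg.
  apply: (@series_le_cvg _ _ (geometric C rho)) => //=.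
  - by move=> n; rewrite mulr_ge0// exprn_ge0.
  - exact: is_cvg_geometric_series.
pose U y := limn (S ^~ y).
have US n y : `|U y - S n y| <= K * rho ^+ n.
  have cSn : `|S (m + n)%N y - S n y| @[m --> \oo] --> `|U y - S n y|.
    apply: cvg_norm; apply: cvgB; last exact: cvg_cst.
    by rewrite (cvg_shiftn n (S ^~ y)); exact: cvgS.
  rewrite -(cvg_lim _ cSn)//; apply: limr_le; first by apply/cvg_ex; eexists; exact: cSn.
  by apply: nearW => m; rewrite addnC; exact: tail.
have mS n : measurable_fun setT (S n).
  rewrite /S /series/=; apply: measurable_sum => j; exact: (Fb j).1.
have bU : bmeasurable U K.
  split; last first.
    move=> y; have := US 0%N y.
    by rewrite /S /series/= big_geq// subr0 expr0 mulr1.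
  by apply: (@measurable_fun_cvg _ _ _ _ S) => // y _; exact: cvgS.
have bS n : bmeasurable (S n) (K + K).
  split => // y; have -> : S n y = U y - (U y - S n y) by rewrite subKr.
  apply: (le_trans (ler_normB _ _)); apply: lerD; first exact: bU.2.
  by apply: (le_trans (US n y)); rewrite ler_piMr// exprn_ile1// ltW.
have kS n y : kop (S n) y = S n.+1 y - f y.
  elim: n => [|n IHn].
    rewrite /S /series/= big_nat1 [X in kop X _](_ : _ = fun=> 0 * 1).
      rewrite (@kopZ 0 (fun=> 1) 1); last by split => // ?; rewrite normr1.
      by rewrite mul0r subrr.
    by apply/funext => z; rewrite big_geq// mul0r.
  have SE m : S m.+1 = fun z => S m z + F m z.
    by apply/funext => z; rewrite /S seriesSr.
  rewrite {1}SE (kopD (bS n) (Fb n)) IHn [in RHS]SE.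
  by rewrite -[kop (F n) y]/(F n.+1 y) addrAC.
exists U; split; first by exists K.
move=> y; apply/eqP; rewrite -subr_eq0 -normr_le0.
have bound n : `|U y - (f y + kop U y)| <= 2 * K * rho ^+ n.
  have bd : bmeasurable (fun z => U z + -1 * S n z) (K * rho ^+ n).
    split; last by move=> z; rewrite mulN1r; exact: US.
    by apply: measurable_funD; [exact: bU.1|exact: measurable_funM].
  have := (kop_bmeasurable bd).2 y.
  rewrite (kopD bU (bmeasurableZ _ (bS n))) (kopZ _ (bS n)) kS mulN1r => h.
  have -> : U y - (f y + kop U y) =
     (U y - S n.+1 y) - (kop U y - (S n.+1 y - f y)) by ring.
  apply: (le_trans (ler_normB _ _)); apply: (le_trans (lerD (US _ _) h)).
  have : K * rho ^+ n.+1 <= K * rho ^+ n.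
    by rewrite ler_wpM2l// exprS ler_piMl ?exprn_ge0// ltW.
  lra.
have c0 : 2 * K * rho ^+ n @[n --> \oo] --> 2 * K * 0.
  by apply: cvgM; [exact: cvg_cst|exact: cvg_expr].
rewrite mulr0 in c0; rewrite -(cvg_lim _ c0)//; apply: limr_ge.
  by apply/cvg_ex; eexists; exact: c0.
by apply: nearW => n; exact: bound.
Qed.

End mixing.

End kernel_operator.

(** It shows that [P H(xstar, .)] has mean zero, as the Poisson equation requires. [H(xstar, .)] may
    be unbounded, so stationarity is passed from sets to its positive and negative parts
    separately. *)
Lemma stationary_kop (R : realType) dX (Xi : measurableType dX)
  (k : R.-pker Xi ~> Xi) (mu : probability Xi R) (h : Xi -> R) :
  stationary k mu -> mu.-integrable setT (EFin \o h) ->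
  (forall y, (k y).-integrable setT (EFin \o h)) ->
  Rintegral mu setT (kop k h) = Rintegral mu setT h.
Proof.
move=> st ih kh.
have mh : measurable_fun setT (EFin \o h) by case/integrableP: ih.
have mh1 : measurable_fun setT (EFin \o h)^\+%E by exact: measurable_funepos.
have mh2 : measurable_fun setT (EFin \o h)^\-%E by exact: measurable_funeneg.
have muE A : measurable A -> (mu A = \int[mu]_y k y A)%E by move=> /st.
have mix g : (forall z, 0 <= g z)%E -> measurable_fun setT g ->
    (\int[mu]_y \int[k y]_z g z = \int[mu]_z g z)%E.
  by move=> g0 mg; rewrite -(@integral_mixture _ _ _ _ _ mu k mu g muE g0 mg).
have mk g : (forall z, 0 <= g z)%E -> measurable_fun setT g ->
    measurable_fun setT (fun y => \int[k y]_z g z)%E.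
  move=> g0 mg.
  apply: (@measurable_fun_integral_kernel _ _ _ _ _ (fun y => k y)) => //.
  exact: measurable_kernel.
have ik g : (forall z, 0 <= g z)%E -> mu.-integrable setT g ->
    mu.-integrable setT (fun y => \int[k y]_z g z)%E.
  move=> g0 ig; have mg : measurable_fun setT g by case/integrableP: ig.
  apply/integrableP; split; first exact: mk.
  under eq_integral do rewrite gee0_abs ?integral_ge0//.
  rewrite mix//; case/integrableP: ig => _.
  by under eq_integral do rewrite gee0_abs//.
have ip := integrable_funepos measurableT ih.
have im := integrable_funeneg measurableT ih.
rewrite [in RHS]/Rintegral (integralE _ _ (EFin \o h)).
rewrite -(mix _ (funepos_ge0 _) mh1) -(mix _ (funeneg_ge0 _) mh2).
rewrite -integralB//; [|exact: ik|exact: ik].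
congr fine; apply: eq_integral => y _.
by rewrite /kop /Rintegral fineK ?(integrable_fin_num _ (kh y))// integralE.
Qed.

(** * The perturbed linear recursion *)

Lemma is_norm_powR_le_sum (R : realType) d (nrm : 'rV[R]_d -> R) (p : R) :
  is_norm nrm -> 0 < p -> exists2 K : R, 0 <= K &
  forall v : 'rV[R]_d, nrm v `^ p <= K * \sum_i `|v 0 i| `^ p.
Proof.
move=> nrmP p0; have [K K0 HK] := is_norm_le_coord nrmP.
exists (K `^ p); first exact: powR_ge0.
move=> v; set s := \sum_i _.
have pow0 (a : R) : 0 <= a `^ p by exact: powR_ge0.
have s0 : 0 <= s by exact: sumr_ge0.
have sp : (s `^ p^-1) `^ p = s.
  by rewrite -powRrM mulVf ?gt_eqF// powRr1.
rewrite -[s in leRHS]sp -powRM ?powR_ge0//.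
apply: le_powR; [exact: ltW|exact: is_norm_ge0|].
apply: HK => i.
have -> : `|v 0 i| = (`|v 0 i| `^ p) `^ p^-1.
  by rewrite -powRrM mulfV ?gt_eqF// powRr1.
apply: le_powR; [by rewrite invr_ge0 ltW|exact: pow0|].
by rewrite /s (bigD1 i)//= lerDl sumr_ge0.
Qed.

(** Here [u] and [u'] stand for consecutive values of [U], and [e] for the defect bounded by (A7).
    The perturbation is written as [a * eta * Q], which makes the bound a convex combination of
    [nrm r] and [Q]; convexity of the [p]-th power then keeps the factor [1 - a * eta] in front of
    [nrm r ^ p], whereas [powRD_le] would multiply it by [2 ^ p]. *)
Lemma residual_step (R : realType) d (nrm : 'rV[R]_d -> R) (p c gamma B : R) :
  is_norm nrm -> 2 < p -> 0 < c -> 0 <= gamma < 1 -> 0 <= B ->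
  exists2 K : R, 0 <= K & forall (eta eta' : R) (r v u u' e : 'rV[R]_d),
  0 < eta <= 1 -> c * eta <= 1 -> 0 <= eta - eta' <= eta ^+ 2 ->
  nrm u <= B -> nrm u' <= B ->
  nrm e <= gamma * c * nrm (r + eta *: u + v) ->
  nrm ((1 - c * eta) *: r - (c * eta ^+ 2) *: u - eta *: e +
       (eta - eta') *: u') `^ p <=
  (1 - c * (1 - gamma) * eta) * nrm r `^ p +
  K * eta * (nrm v `^ p + eta `^ (p / 2)).
Proof.
move=> nrmP p2 c0 /andP[g0 g1] B0.
pose a := c * (1 - gamma).
have a0 : 0 < a by rewrite mulr_gt0// subr_gt0.
have p0 : 0 <= p by lra.
(* After division by [eta ^+ 2], the three terms bound the contribution of [u] through [e], the
   explicit term in [u], and the term in [u']. *)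
pose B' := gamma * c * B + c * B + B.
have gc0 : 0 <= gamma * c by rewrite mulr_ge0// ltW.
have cB0 : 0 <= c * B by rewrite mulr_ge0// ltW.
have B'0 : 0 <= B' by rewrite /B' !addr_ge0// mulr_ge0.
pose K1 := ((gamma * c) / a) `^ p + (B' / a) `^ p.
have K10 : 0 <= K1 by rewrite addr_ge0// powR_ge0.
exists (a * (2 `^ p * K1)).
  by apply: mulr_ge0; [exact: ltW|rewrite mulr_ge0// powR_ge0].
move=> eta eta' r v u u' e /andP[eta0 eta1] ceta deta uB u'B eD.
have [deta0 deta1] := andP deta.
have N0 := is_norm_ge0 nrmP.
have aeta : 0 <= a * eta <= 1.
  apply/andP; split; first by rewrite mulr_ge0// ltW.
  apply: le_trans ceta; rewrite ler_pM2r// /a ler_piMr//; [exact: ltW|lra].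
pose Q := gamma * c / a * nrm v + B' / a * eta.
have Q0 : 0 <= Q.
  by rewrite addr_ge0// mulr_ge0// ?divr_ge0// ltW.
have le1 : nrm ((1 - c * eta) *: r - (c * eta ^+ 2) *: u - eta *: e +
       (eta - eta') *: u') <= (1 - a * eta) * nrm r + a * eta * Q.
  have eta20 : 0 <= c * eta ^+ 2 by rewrite mulr_ge0 ?sqr_ge0// ltW.
  apply: (@le_trans _ _ ((1 - c * eta) * nrm r + c * eta ^+ 2 * B +
      eta * (gamma * c * (nrm r + eta * B + nrm v)) + eta ^+ 2 * B)).
    apply: (le_trans (is_normD nrmP _ _)); apply: lerD; last first.
      by rewrite (is_normZ nrmP) ger0_norm//; apply: ler_pM.
    apply: (le_trans (is_normD nrmP _ _)); apply: lerD; last first.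
      rewrite (is_normN nrmP) (is_normZ nrmP) gtr0_norm// ler_pM2l//.
      apply: (le_trans eD); rewrite ler_wpM2l//.
      apply: (le_trans (is_normD nrmP _ _)); rewrite lerD2r.
      apply: (le_trans (is_normD nrmP _ _)); rewrite lerD2l.
      by rewrite (is_normZ nrmP) gtr0_norm// ler_pM2l.
    apply: (le_trans (is_normD nrmP _ _)); apply: lerD.
      by rewrite (is_normZ nrmP) ger0_norm// subr_ge0.
    by rewrite (is_normN nrmP) (is_normZ nrmP) ger0_norm// ler_wpM2l.
  have -> : a * eta * Q = eta * (gamma * c * nrm v + B' * eta).
    by rewrite /Q; field; rewrite gt_eqF.
  rewrite /a /B' le_eqVlt; apply/orP; left; apply/eqP; ring.
have p1 : 1 <= p by lra.
apply: (le_trans (le_powR p0 (N0 _) le1)).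
apply: (le_trans (powR_convex p1 aeta (N0 r) Q0)).
rewrite -/a lerD2l.
have Qp : Q `^ p <= 2 `^ p * (K1 * (nrm v `^ p + eta `^ (p / 2))).
  have q1 : 0 <= gamma * c / a * nrm v by rewrite mulr_ge0// divr_ge0// ltW.
  have q2 : 0 <= B' / a * eta by rewrite mulr_ge0 ?divr_ge0// ltW.
  apply: (le_trans (powRD_le p0 q1 q2)).
  rewrite ler_wpM2l ?powR_ge0//.
  have A1 : 0 <= gamma * c / a by rewrite divr_ge0// ltW.
  have A2 : 0 <= B' / a by rewrite divr_ge0// ltW.
  rewrite (powRM _ A1 (N0 v)) (powRM _ A2 (ltW eta0)).
  have hE : eta `^ p <= eta `^ (p / 2).
    by apply: ger_powR; [rewrite eta0|lra].
  rewrite /K1 [leRHS]mulrDl; apply: lerD.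
    by rewrite ler_wpM2l ?powR_ge0// lerDl powR_ge0.
  rewrite ler_wpM2l ?powR_ge0//.
  by apply: (le_trans hE); rewrite lerDr powR_ge0.
have -> : a * (2 `^ p * K1) * eta * (nrm v `^ p + eta `^ (p / 2)) =
  a * eta * (2 `^ p * (K1 * (nrm v `^ p + eta `^ (p / 2)))) by ring.
by rewrite ler_wpM2l//; case/andP: aeta.
Qed.

(** If the [p]-th moment of [Z] is infinite, the right side is infinite because [beta] is positive;
    otherwise all terms are integrable and the linear one vanishes. *)
Lemma ge0_integral_lin_le (R : realType) d (T : measurableType d)
  (mu : {measure set T -> \bar R}) (F Z : T -> R) (p l alpha beta : R) :
  mu setT = 1%E -> 0 < beta -> 0 <= alpha ->
  measurable_fun setT F -> (forall z, 0 <= F z) ->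
  mu.-integrable setT (EFin \o Z) -> Rintegral mu setT Z = 0 ->
  (forall z, F z <= alpha + l * Z z + beta * `|Z z| `^ p) ->
  (\int[mu]_z (F z)%:E <=
     alpha%:E + beta%:E * \int[mu]_z (`|Z z| `^ p)%:E)%E.
Proof.
move=> mu1 beta0 alpha0 mF F0 iZ Z0 FZ.
have mZ : measurable_fun setT Z by apply/measurable_EFinP; case/integrableP: iZ.
have mZp : measurable_fun setT (fun z => `|Z z| `^ p).
  apply: (measurableT_comp (measurable_powR p)); exact: measurableT_comp.
have I0 : (0 <= \int[mu]_z (`|Z z| `^ p)%:E)%E.
  by apply: integral_ge0 => z _; rewrite lee_fin powR_ge0.
have [Ioo|Ifin] := eqVneq (\int[mu]_z (`|Z z| `^ p)%:E)%E +oo%E.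
  by rewrite Ioo gt0_muley ?lte_fin// addey ?leey.
have iZp : mu.-integrable setT (fun z => (`|Z z| `^ p)%:E).
  apply/integrableP; split; first exact/measurable_EFinP.
  under eq_integral do rewrite gee0_abs ?lee_fin ?powR_ge0//.
  by rewrite lt_neqAle Ifin leey.
have ic : mu.-integrable setT (fun=> alpha%:E).
  by apply: (@bmeasurable_integrable _ _ _ mu (fun=> alpha) `|alpha|).
have iZ' : mu.-integrable setT (fun z => l%:E * (Z z)%:E)%E.
  exact: integrableZl.
have iZp' : mu.-integrable setT (fun z => beta%:E * (`|Z z| `^ p)%:E)%E.
  exact: integrableZl.
apply: (@le_trans _ _
  (\int[mu]_z (alpha%:E + l%:E * (Z z)%:E + beta%:E * (`|Z z| `^ p)%:E))%E).
  apply: ge0_le_integral => //.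
  - by move=> z _; rewrite lee_fin.
  - exact/measurable_EFinP.
  - apply: emeasurable_funD; last exact: (measurable_int mu).
    by apply: emeasurable_funD => //; exact: (measurable_int mu).
  - by move=> z _; rewrite -!EFinM -!EFinD lee_fin.
rewrite integralD//; last exact: integrableD.
rewrite integralD// integralZl// integralZl//.
rewrite integral_cst// mu1 mule1.
have -> : (\int[mu]_z (Z z)%:E = 0)%E.
  rewrite -[LHS]fineK; last exact: integrable_fin_num.
  by move: Z0; rewrite /Rintegral => ->.
by rewrite mule0 adde0.
Qed.

(** * The martingale noise and its conditional moments *)

Section noise.
Context {R : realType} {d : nat} {dX : measure_display}
  {Xi : measurableType dX} {dO : measure_display} {Omega : measurableType dO}.
Variables (nrm : 'rV[R]_d -> R) (k : R.-pker Xi ~> Xi)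
  (Pr : probability Omega R) (xi : nat -> Omega -> Xi)
  (H : 'rV[R]_d -> Xi -> 'rV[R]_d) (xstar : 'rV[R]_d)
  (U : Xi -> 'rV[R]_d) (p gamma c L BH BU : R).
Hypothesis nrmP : is_norm nrm.
Hypothesis mc : markov_chain Pr k xi.
Hypothesis mH : jointly_measurable H.
Hypothesis p2 : 2 < p.
Hypothesis H_moment : forall t,
  (\int[Pr]_w ((nrm (H xstar (xi t w))) `^ p)%:E <= BH%:E)%E.
Hypothesis H_integrable : forall y (i : 'I_d),
  (k y).-integrable setT (fun z => (H xstar z 0 i)%:E).
Hypothesis L0 : 0 <= L.
Hypothesis H_Lipschitz : forall x y z,
  (\int[k z]_y' ((nrm (H x y' - H y y')) `^ p)%:E
     <= ((L * nrm (x - y)) `^ p)%:E)%E.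
Hypothesis gamma01 : 0 <= gamma < 1.
Hypothesis c0 : 0 < c.
Hypothesis contraction : forall x y z,
  nrm (Pvec k (fun y' => H x y' - H y y') z - c *: (x - y))
    <= gamma * c * nrm (x - y).
Hypothesis U_bounded : forall i, bmeasurable (fun y => U y 0 i) BU.
Hypothesis U_poisson : forall y (i : 'I_d),
  U y 0 i = Pvec k (H xstar) y 0 i + kop k (fun z => U z 0 i) y.

Let mxi : forall t, measurable_fun setT (xi t) := mc.1.

Definition drift (x : 'rV[R]_d) (y : Xi) : 'rV[R]_d :=
  Pvec k (fun z => H x z - H xstar z) y.

(** [y] is the previous state and [z] the new one. The two subtracted terms form the mean of
    [H x z + U z] under [k y], by the Poisson equation. *)
Definition noise (x : 'rV[R]_d) (y z : Xi) : 'rV[R]_d :=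
  H x z + U z - drift x y - U y.

Lemma measurable_H x i : measurable_fun setT (fun z => H x z 0 i).
Proof.
exact: (@measurable_jointly _ _ _ Xi _ Xi H (fun=> x) id i).
Qed.

Lemma measurable_nrm_H x : measurable_fun setT (fun z => nrm (H x z)).
Proof. by apply: measurable_nrm => // i; exact: measurable_H. Qed.

Lemma measurable_nrm_HB x :
  measurable_fun setT (fun z => nrm (H x z - H xstar z)).
Proof.
apply: measurable_nrm => // i.
under eq_fun do rewrite !mxE.
by apply: measurable_funB; exact: measurable_H.
Qed.

(** (A3) bounds a [p]-th moment, which controls the first moment through [a <= 1 + a ^ p]. *)
Lemma HB_integrable x y i :
  (k y).-integrable setT (fun z => ((H x z - H xstar z) 0 i)%:E).
Proof.
have mHB : measurable_fun setT (fun z => (H x z - H xstar z) 0 i).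
  by under eq_fun do rewrite !mxE; apply: measurable_funB; exact: measurable_H.
have [K K0 HK] := coord_le_is_norm nrmP.
apply: (@le_integrable _ _ _ _ _ measurableT _
  (fun z => (K * (1 + nrm (H x z - H xstar z) `^ p))%:E)).
- exact/measurable_EFinP.
- move=> z _; rewrite /= lee_fin.
  apply: (le_trans (HK _ i)); rewrite [leRHS]ger0_norm; last first.
    by rewrite mulr_ge0// addr_ge0// powR_ge0.
  rewrite ler_wpM2l//; set a := nrm _.
  have [a1|a1] := leP a 1.
    by apply: (le_trans a1); rewrite lerDl powR_ge0.
  apply: (@le_trans _ _ (a `^ p)); last by rewrite lerDr.
  by apply: le1r_powR; [exact: ltW|have := p2; lra].
have mp : measurable_fun setT (fun z => nrm (H x z - H xstar z) `^ p).
  exact: (measurableT_comp (measurable_powR p) (measurable_nrm_HB x)).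
apply/integrableP; split.
  by apply/measurable_EFinP; apply: measurable_funM => //; exact: measurable_funD.
under eq_integral.
  move=> z _; rewrite gee0_abs; last first.
    by rewrite lee_fin mulr_ge0// addr_ge0// powR_ge0.
  rewrite EFinM EFinD; over.
rewrite ge0_integralZl//; last 2 first.
  by apply: emeasurable_funD => //; exact/measurable_EFinP.
  by move=> z _; rewrite -EFinD lee_fin addr_ge0// powR_ge0.
rewrite ge0_integralD//; last 2 first.
  by move=> z _; rewrite lee_fin powR_ge0.
  exact/measurable_EFinP.
rewrite integral_cst// [X in (1 * X)%E]prob_kernel mule1.
apply: (@le_lt_trans _ _ (K%:E * (1 + ((L * nrm (x - xstar)) `^ p)%:E))%E).
  by rewrite lee_wpmul2l ?lee_fin// leeD2l// H_Lipschitz.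
by rewrite -EFinD -EFinM ltry.
Qed.

Lemma noise_integrable x y i : (k y).-integrable setT
  (fun z => (noise x y z 0 i)%:E).
Proof.
have -> : (fun z => (noise x y z 0 i)%:E) =
    (fun z => ((H x z - H xstar z) 0 i)%:E + (H xstar z 0 i)%:E +
      (U z 0 i)%:E + (- drift x y 0 i - U y 0 i)%:E)%E.
  by apply/funext => z; rewrite -!EFinD; congr EFin; rewrite !mxE; ring.
have iU : (k y).-integrable setT (fun z => (U z 0 i)%:E).
  exact: bmeasurable_integrable (prob_kernel y) (U_bounded i).
have ic : (k y).-integrable setT (fun=> (- drift x y 0 i - U y 0 i)%:E).
  by apply: (@bmeasurable_integrable _ _ _ (k y) (fun=> _)
    `|- drift x y 0 i - U y 0 i|) => //; exact: prob_kernel.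
apply: integrableD => //; apply: integrableD => //; apply: integrableD => //.
exact: HB_integrable.
Qed.

Lemma noise_mean0 x y i :
  Rintegral (k y) setT (fun z => noise x y z 0 i) = 0.
Proof.
have iU : (k y).-integrable setT (fun z => (U z 0 i)%:E).
  exact: bmeasurable_integrable (prob_kernel y) (U_bounded i).
have ic : (k y).-integrable setT (fun=> (- drift x y 0 i - U y 0 i)%:E).
  by apply: (@bmeasurable_integrable _ _ _ (k y) (fun=> _)
    `|- drift x y 0 i - U y 0 i|) => //; exact: prob_kernel.
have -> : (fun z => noise x y z 0 i) =
    (fun z => (((H x z - H xstar z) 0 i) + (H xstar z 0 i)) + (U z 0 i) +
      (- drift x y 0 i - U y 0 i)).
  by apply/funext => z; rewrite !mxE; ring.
have i1 := HB_integrable x y i.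
have i2 : (k y).-integrable setT (EFin \o (fun z => H xstar z 0 i)).
  exact: H_integrable.
have i12 := integrableD measurableT i1 i2.
have i123 := integrableD measurableT i12 iU.
rewrite RintegralD// RintegralD// RintegralD//.
rewrite Rintegral_cst// [X in fine X](_ : _ = 1%E); last exact: prob_kernel.
rewrite mulr1 [U y 0 i]U_poisson /kop /drift !mxE; ring.
Qed.

Lemma drift_le : exists2 K, 0 <= K &
  forall x y i, `|drift x y 0 i| <= K * nrm (x - xstar).
Proof.
have [K K0 HK] := coord_le_is_norm nrmP.
have [g0 g1] := andP gamma01.
exists (K * (gamma * c + c)).
  by rewrite mulr_ge0// addr_ge0// ?mulr_ge0// ltW.
move=> x y i; apply: (le_trans (HK _ i)).
rewrite -mulrA ler_wpM2l//.
have -> : drift x y = (drift x y - c *: (x - xstar)) + c *: (x - xstar).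
  by rewrite subrK.
apply: (le_trans (is_normD nrmP _ _)); rewrite mulrDl; apply: lerD; first exact: contraction.
by rewrite (is_normZ nrmP) gtr0_norm.
Qed.

(** The moment of [H(xstar, .)] under [k y] is kept as an integral: (A2) bounds it along the chain
    but not uniformly in [y], so it becomes a constant only after averaging over [Pr]. *)
Lemma noise_moment : exists2 K, 0 <= K & forall x y i,
  (\int[k y]_z (`|noise x y z 0 i| `^ p)%:E <=
   (K * (1 + nrm (x - xstar) `^ p))%:E +
   K%:E * \int[k y]_z (nrm (H xstar z) `^ p)%:E)%E.
Proof.
have [Kc Kc0 HKc] := coord_le_is_norm nrmP.
have [Kd Kd0 HKd] := drift_le.
pose K1 := Kc + Kd + 2 * `|BU|.
have K10 : 0 <= K1 by rewrite !addr_ge0// mulr_ge0.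
have p0 : 0 <= p by have := p2; lra.
have pow0 a : 0 <= a `^ p :> R by exact: powR_ge0.
pose T := 2 `^ p : R.
have T0 : 0 <= T by exact: pow0.
have T1 : 1 <= T by rewrite /T -[leLHS](powRr0 2) ler_powR//; lra.
pose A := K1 `^ p * (T * (T * T)).
have A0 : 0 <= A by rewrite mulr_ge0// !mulr_ge0.
have pt x y z i : `|noise x y z 0 i| `^ p <=
    A * (nrm (H x z - H xstar z) `^ p) +
    (A * (1 + nrm (x - xstar) `^ p) + A * nrm (H xstar z) `^ p).
  set a := nrm _; set b := nrm (x - xstar); set e := nrm (H xstar z).
  have a0 : 0 <= a by exact: is_norm_ge0.
  have b0 : 0 <= b by exact: is_norm_ge0.
  have e0 : 0 <= e by exact: is_norm_ge0.
  have le1 : `|noise x y z 0 i| <= K1 * ((a + e) + (1 + b)).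
    have -> : noise x y z 0 i = (H x z - H xstar z) 0 i + H xstar z 0 i
        + (U z 0 i - U y 0 i) - drift x y 0 i by rewrite !mxE; ring.
    apply: (@le_trans _ _ (Kc * a + Kc * e + 2 * `|BU| + Kd * b)).
      apply: (le_trans (ler_normB _ _)); apply: lerD; last exact: HKd.
      apply: (le_trans (ler_normD _ _)); apply: lerD.
        by apply: (le_trans (ler_normD _ _)); apply: lerD; exact: HKc.
      apply: (le_trans (ler_normB _ _)).
      have := (U_bounded i).2 z; have := (U_bounded i).2 y.
      have := ler_norm BU; lra.
    rewrite /K1; move: (`|BU|) (normr_ge0 BU) => u u0; nra.
  apply: (le_trans (le_powR p0 (normr_ge0 _) le1)).
  rewrite powRM ?addr_ge0//.
  apply: (@le_trans _ _ (K1 `^ p * (T * (T * (a `^ p + e `^ p) +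
                                         T * (1 + b `^ p))))).
    rewrite ler_wpM2l//; apply: (le_trans (powRD_le p0 _ _)); rewrite ?addr_ge0//.
    rewrite ler_wpM2l// lerD ?powRD_le//.
    by apply: (le_trans (powRD_le p0 _ _)); rewrite // powR1.
  rewrite /A -!mulrA -!mulrDr ler_wpM2l// ler_wpM2l// ler_wpM2l//.
  have Y0 : 0 <= a `^ p + (1 + b `^ p + e `^ p) by rewrite !addr_ge0.
  apply: (@le_trans _ _ (a `^ p + (1 + b `^ p + e `^ p))); first lra.
  by rewrite ler_peMl.
exists (A * (L `^ p + 1)); first by rewrite mulr_ge0// addr_ge0.
move=> x y i.
have mHB := measurableT_comp (measurable_powR p) (measurable_nrm_HB x).
have mHs := measurableT_comp (measurable_powR p) (measurable_nrm_H xstar).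
have mN : measurable_fun setT (fun z => noise x y z 0 i).
  by apply/measurable_EFinP; case/integrableP: (noise_integrable x y i).
apply: (@le_trans _ _ (\int[k y]_z
   (A%:E * (nrm (H x z - H xstar z) `^ p)%:E +
    ((A * (1 + nrm (x - xstar) `^ p))%:E +
     A%:E * (nrm (H xstar z) `^ p)%:E)))%E).
  apply: ge0_le_integral => //.
  - apply/measurable_EFinP; apply: (measurableT_comp (measurable_powR p)).
    exact: measurableT_comp.
  - apply/measurable_EFinP => /=.
    apply: measurable_funD; first exact: measurable_funM.
    by apply: measurable_funD => //; exact: measurable_funM.
  - by move=> z _; rewrite -!EFinM -!EFinD lee_fin.
have e0 z : (0 <= A%:E * (nrm (H xstar z) `^ p)%:E)%E.
  by rewrite -EFinM lee_fin mulr_ge0.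
have b0 : 0 <= A * (1 + nrm (x - xstar) `^ p) by rewrite mulr_ge0// addr_ge0.
rewrite ge0_integralD//; last 4 first.
  - by move=> z _; rewrite -EFinM lee_fin mulr_ge0.
  - by apply/measurable_EFinP; exact: measurable_funM.
  - by move=> z _; rewrite adde_ge0// lee_fin.
  - apply/measurable_EFinP => /=.
    by apply: measurable_funD => //; exact: measurable_funM.
rewrite [X in (_ + X)%E]ge0_integralD//; last first.
  by apply/measurable_EFinP; exact: measurable_funM.
rewrite ge0_integralZl//; last 2 first.
  - exact/measurable_EFinP.
  - by move=> z _; rewrite lee_fin.
rewrite [X in (_ + (_ + X))%E]ge0_integralZl//; last 2 first.
  - exact/measurable_EFinP.
  - by move=> z _; rewrite lee_fin.
rewrite integral_cst// [X in (_ + (_ * X + _))%E]prob_kernel mule1 addeA.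
apply: leeD.
  rewrite -[leRHS]/(_%:E).
  apply: (@le_trans _ _
     (A%:E * ((L * nrm (x - xstar)) `^ p)%:E +
      (A * (1 + nrm (x - xstar) `^ p))%:E)%E).
    by rewrite leeD2r// lee_wpmul2l// lee_fin.
  rewrite -EFinM -EFinD lee_fin powRM// ?is_norm_ge0//.
  have := pow0 L; have := pow0 (nrm (x - xstar)).
  move: (L `^ p) (_ `^ p) => u v v0 u0.
  have : 0 <= A * u by rewrite mulr_ge0.
  by lra.
apply: lee_wpmul2r; last by rewrite lee_fin ler_peMr// lerDr.
by apply: integral_ge0 => z _; rewrite lee_fin.
Qed.

Lemma measurable_noise s (x : history xi s -> 'rV[R]_d) i :
  (forall j, measurable_fun setT (fun w => x w 0 j)) ->
  measurable_fun setT
    (fun wz : history xi s * Xi => noise (x wz.1) (xi s wz.1) wz.2 0 i).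
Proof.
move=> mx.
have mx1 j : measurable_fun setT (fun wz : history xi s * Xi => x wz.1 0 j).
  exact: measurableT_comp (mx j) measurable_fst.
have mxis := @history_measurable_xi _ _ _ _ xi s s (leqnn s).
have mU (f : history xi s * Xi -> Xi) : measurable_fun setT f ->
    measurable_fun setT (fun wz => U (f wz) 0 i).
  by move=> mf; exact: measurableT_comp (U_bounded i).1 mf.
have mD : measurable_fun setT
    (fun w : history xi s => drift (x w) (xi s w) 0 i).
  rewrite /drift /Pvec; under eq_fun do rewrite mxE.
  apply: (@measurable_Rintegral_kprecomp _ _ _ _ _ _ _ k
    (xi s : history xi s -> Xi)
    (fun wz : history xi s * Xi => (H (x wz.1) wz.2 - H xstar wz.2) 0 i)) => //.
  under eq_fun do rewrite !mxE.
  apply: measurable_funB; first exact: measurable_jointly.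
  exact: measurableT_comp (measurable_H xstar i) measurable_snd.
have -> : (fun wz : history xi s * Xi => noise (x wz.1) (xi s wz.1) wz.2 0 i) =
    (fun wz => H (x wz.1) wz.2 0 i + U wz.2 0 i -
       drift (x wz.1) (xi s wz.1) 0 i - U (xi s wz.1) 0 i).
  by apply/funext => wz; rewrite !mxE.
apply: measurable_funB; last first.
  by apply: mU; apply: (measurableT_comp mxis); exact: measurable_fst.
apply: measurable_funB.
  2: by apply: (measurableT_comp mD); exact: measurable_fst.
by apply: measurable_funD; [exact: measurable_jointly|exact: mU].
Qed.

Lemma noise_step : exists2 K, 0 <= K &
  forall s (x v : history xi s -> 'rV[R]_d) eta i,
  (forall j, measurable_fun setT (fun w => x w 0 j)) ->
  (forall j, measurable_fun setT (fun w => v w 0 j)) ->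
  0 < eta <= 1 -> c * eta <= 1 ->
  (\int[Pr]_w (`|(1 - c * eta) * v w 0 i -
       eta * noise (x w) (xi s w) (xi s.+1 w) 0 i| `^ p)%:E <=
   \int[Pr]_w ((1 - c / 2 * eta) * `|v w 0 i| `^ p +
     K * eta `^ (1 + p / 2) * (1 + nrm (x w - xstar) `^ p))%:E)%E.
Proof.
have [K1 K10 HK1] := contraction_noise_le p2 c0.
have [K2 K20 HK2] := noise_moment.
exists (K1 * (K2 + K2 * `|BH|)).
  by apply: mulr_ge0; [exact: ltW|rewrite addr_ge0// mulr_ge0].
move=> s x v eta i mx mv eta01 ceta.
have [eta0 eta1] := andP eta01.
pose W := eta `^ (1 + p / 2).
have W0 : 0 < W by exact: powR_gt0.
have mN := measurable_noise i mx.
have ceta0 : 0 <= 1 - c / 2 * eta.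
  have : 0 < c * eta by exact: mulr_gt0.
  by move: ceta; lra.
pose F (wz : history xi s * Xi) : R := `|(1 - c * eta) * v wz.1 0 i -
       eta * noise (x wz.1) (xi s wz.1) wz.2 0 i| `^ p.
have mF : measurable_fun setT F.
  apply: (measurableT_comp (measurable_powR p)); apply: measurableT_comp => //.
  apply: measurable_funB; apply: measurable_funM => //.
  exact: measurableT_comp (mv i) measurable_fst.
have F0 wz : 0 <= F wz by exact: powR_ge0.
rewrite -[leLHS]/(\int[Pr]_w (EFin \o F) (w : history xi s, xi s.+1 w))%E.
rewrite (markov_integral mc)//; last exact/measurable_EFinP.
pose G (w : history xi s) : R := (1 - c / 2 * eta) * `|v w 0 i| `^ p +
  K1 * W * K2 * (1 + nrm (x w - xstar) `^ p).
have mHs : measurable_fun setT (fun z => nrm (H xstar z) `^ p).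
  exact: measurableT_comp (measurable_powR p) (measurable_nrm_H xstar).
have mlin a b : measurable_fun setT (fun w : Omega =>
    a * `|v w 0 i| `^ p + b * (1 + nrm (x w - xstar) `^ p)).
  apply: (@measurableT_comp _ _ _ _ _ _ (fun w : history xi s =>
    a * `|v w 0 i| `^ p + b * (1 + nrm (x w - xstar) `^ p)) _ _ _
    (measurable_history mxi s)).
  apply: measurable_funD; apply: measurable_funM => //.
    apply: (measurableT_comp (measurable_powR p)).
    exact: measurableT_comp (mv i).
  apply: measurable_funD => //; apply: (measurableT_comp (measurable_powR p)).
  apply: measurable_nrm => // j; under eq_fun do rewrite !mxE.
  exact: measurable_funB.
have mG : measurable_fun setT (fun w : Omega => G w) by exact: mlin.
have G0 w : 0 <= G w.
  apply: addr_ge0; first by rewrite mulr_ge0// powR_ge0.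
  rewrite mulr_ge0//; first by rewrite !mulr_ge0// ltW.
  by rewrite addr_ge0// powR_ge0.
have mI : measurable_fun setT
    (fun w : Omega => \int[k (xi s w)]_z (nrm (H xstar z) `^ p)%:E)%E.
  apply: (@measurable_integral_kprecomp _ _ _ _ _ _ _ k (xi s)
    (fun wz : Omega * Xi => (nrm (H xstar wz.2) `^ p)%:E)) => //.
  - apply/measurable_EFinP; apply: (measurableT_comp mHs).
    exact: measurable_snd.
  - by move=> wz; rewrite lee_fin powR_ge0.
have I0 w : (0 <= \int[k (xi s w)]_z (nrm (H xstar z) `^ p)%:E)%E.
  by apply: integral_ge0 => z _; rewrite lee_fin powR_ge0.
have KWK0 : 0 <= K1 * W * K2 by rewrite !mulr_ge0// ltW.
apply: (@le_trans _ _ (\int[Pr]_w ((G w)%:E +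
  (K1 * W * K2)%:E * \int[k (xi s w)]_z (nrm (H xstar z) `^ p)%:E))%E).
  apply: ge0_le_integral => //.
  - by move=> w _; apply: integral_ge0 => z _; rewrite lee_fin.
  - apply: (@measurableT_comp _ _ _ _ _ _
      (fun w : history xi s => \int[k (xi s w)]_z (F (w, z))%:E)%E _ _ _
      (measurable_history mxi s)).
    apply: (@measurable_integral_kprecomp _ _ _ _ _ _ _ k
      (xi s : history xi s -> Xi) (EFin \o F)).
    + exact: history_measurable_xi.
    + exact/measurable_EFinP.
    + by move=> wz; rewrite lee_fin.
  - apply: emeasurable_funD; first exact/measurable_EFinP.
    exact: measurable_funeM.
  (* Once the past [w] is fixed, [l] is a constant and the centred noise removes it inside the inner
     integral, so no measurable choice of [l] in [w] arises. *)
  move=> w _; have [l Hl] := HK1 eta (v w 0 i) eta01 ceta.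
  have iN := noise_integrable (x w) (xi s w) i.
  have mFw : measurable_fun setT (fun z => F ((w : history xi s), z)).
    exact: (measurableT_comp mF (measurable_pair1 (w : history xi s))).
  apply: le_trans.
    apply: (@ge0_integral_lin_le _ _ _ (k (xi s w))
      (fun z => F ((w : history xi s), z))
      (fun z => noise (x w) (xi s w) z 0 i) p l
      ((1 - c / 2 * eta) * `|v w 0 i| `^ p) (K1 * W)) => //.
    - exact: prob_kernel.
    - by rewrite mulr_gt0.
    - by rewrite mulr_ge0// powR_ge0.
    - exact: noise_mean0.
    - by move=> z; exact: Hl.
  rewrite /G EFinD -addeA; apply: leeD => //.
  apply: (@le_trans _ _ ((K1 * W)%:E *
     ((K2 * (1 + nrm (x w - xstar) `^ p))%:E +
      K2%:E * \int[k (xi s w)]_z (nrm (H xstar z) `^ p)%:E))%E).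
    by apply: lee_wpmul2l; [rewrite lee_fin mulr_ge0// ltW|exact: HK2].
  rewrite ge0_muleDr//; last by rewrite mule_ge0.
    by rewrite -EFinM muleA -EFinM !mulrA.
  by rewrite lee_fin mulr_ge0// addr_ge0// powR_ge0.
rewrite ge0_integralD//; last 4 first.
  - by move=> w _; rewrite lee_fin.
  - exact/measurable_EFinP.
  - by move=> w _; rewrite mule_ge0.
  - exact: measurable_funeM.
rewrite ge0_integralZl//.
(* Averaging the kernel moment over [Pr] gives the moment of the chain at time [s.+1], to which
   [H_moment] applies. *)
have -> : (\int[Pr]_w \int[k (xi s w)]_z (nrm (H xstar z) `^ p)%:E =
    \int[Pr]_w (nrm (H xstar (xi s.+1 w)) `^ p)%:E)%E.
  rewrite -(@markov_integral _ _ _ _ _ _ _ _ s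
    (fun wz : history xi s * Xi => (nrm (H xstar wz.2) `^ p)%:E) mc)//.
  - by move=> wz; rewrite lee_fin powR_ge0.
  - apply/measurable_EFinP; apply: (measurableT_comp mHs).
    exact: measurable_snd.
apply: (@le_trans _ _ (\int[Pr]_w (G w)%:E + (K1 * W * K2)%:E * `|BH|%:E)%E).
  rewrite leeD2l// lee_wpmul2l ?lee_fin//; apply: (le_trans (H_moment _)).
  by rewrite lee_fin ler_norm.
have -> : ((K1 * W * K2)%:E * `|BH|%:E =
    \int[Pr]_w (K1 * W * K2 * `|BH|)%:E)%E.
  rewrite integral_cst// [X in _ = (_ * X)%E](_ : _ = 1%E) ?mule1 ?EFinM//.
  exact: probability_setT.
rewrite -ge0_integralD//; last 3 first.
  - by move=> w _; rewrite lee_fin.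
  - exact/measurable_EFinP.
  - by move=> w _; rewrite lee_fin mulr_ge0.
apply: ge0_le_integral => //.
- by move=> w _; rewrite -EFinD lee_fin addr_ge0// mulr_ge0.
- by apply: emeasurable_funD => //; exact/measurable_EFinP.
- by apply/measurable_EFinP; exact: mlin.
move=> w _; rewrite -EFinD lee_fin /G -/W -addrA lerD2l.
have -> : K1 * (K2 + K2 * `|BH|) * W * (1 + nrm (x w - xstar) `^ p) =
   K1 * W * K2 * (1 + nrm (x w - xstar) `^ p) +
   K1 * W * K2 * `|BH| * (1 + nrm (x w - xstar) `^ p) by ring.
rewrite lerD2l ler_peMr//; first by rewrite mulr_ge0.
by rewrite lerDl powR_ge0.
Qed.

(** * The decomposition of the iterates and its Lyapunov function *)

Section recursion.
Variables (eta : nat -> R) (x0 : 'rV[R]_d).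
Hypothesis eta01 : forall t, 0 < eta t <= 1.

Local Notation x := (iterates H eta x0 xi).

Lemma measurable_iterates s i :
  measurable_fun setT (fun w : history xi s => x s.+1 w 0 i).
Proof.
elim: s i => [|s IHs] i.
  have -> : (fun w : history xi 0 => x 1 w 0 i) =
      (fun w => x0 0 i - eta 0 * H x0 (xi 0 w) 0 i).
    by apply/funext => w; rewrite /= !mxE.
  apply: measurable_funB => //; apply: measurable_funM => //.
  apply: (measurableT_comp (measurable_H x0 i)).
  exact: (@history_measurable_xi _ _ _ _ xi 0 0).
have mx j : measurable_fun setT (fun w : history xi s.+1 => x s.+1 w 0 j).
  exact: (measurableT_comp (IHs j) (@historyS _ _ _ _ xi s)).
have -> : (fun w : history xi s.+1 => x s.+2 w 0 i) =
    (fun w => x s.+1 w 0 i - eta s.+1 * H (x s.+1 w) (xi s.+1 w) 0 i).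
  by apply/funext => w; rewrite [in LHS]/= !mxE.
apply: measurable_funB => //; apply: measurable_funM => //.
apply: measurable_jointly => //.
exact: (@history_measurable_xi _ _ _ _ xi s.+1 s.+1).
Qed.

(* [x 0] is not preceded by a state of the chain, hence the shift by one: at
   step [n] the iterate is [x (S + n).+1], a function of xi 0, ..., xi (S + n). *)
Fixpoint martingale_part (S n : nat) (w : Omega) : 'rV[R]_d :=
  if n is n'.+1 then
    (1 - c * eta (S + n').+1) *: martingale_part S n' w -
    eta (S + n').+1 *:
      noise (x (S + n').+1 w) (xi (S + n') w) (xi (S + n').+1 w)
  else 0.

(** The decomposition starts at a time [S] with martingale part 0, so the residual inherits the
    initial error. [S] is fixed only in [iterates_moment_rate], late enough for the step sizes to
    suit the constants of [lyapunov_step]. *)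
Definition residual (S n : nat) (w : Omega) : 'rV[R]_d :=
  x (S + n).+1 w - xstar - eta (S + n).+1 *: U (xi (S + n) w) -
  martingale_part S n w.

Lemma measurable_martingale_part S n i : measurable_fun setT
  (fun w : history xi (S + n) => martingale_part S n w 0 i).
Proof.
elim: n i => [|n IHn] i /=.
  by under eq_fun do rewrite mxE; exact: measurable_cst.
(* The type [history xi (S + n.+1)] depends on the index, which is generalised before it is
   rewritten as a successor. *)
move: (S + n.+1)%N (addnS S n) => s ->.
move: (S + n)%N IHn => {}s IHn.
have -> : (fun w : history xi s.+1 =>
    ((1 - c * eta s.+1) *: martingale_part S n w -
     eta s.+1 *: noise (x s.+1 w) (xi s w) (xi s.+1 w)) 0 i) =
  (fun w => (1 - c * eta s.+1) * martingale_part S n w 0 i -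
     eta s.+1 * noise (x s.+1 w) (xi s w) (xi s.+1 w) 0 i).
  by apply/funext => w; rewrite 4!mxE [in RHS]/= mxE.
apply: measurable_funB; apply: measurable_funM => //.
  exact: (measurableT_comp (IHn i) (@historyS _ _ _ _ xi s)).
apply: (@measurableT_comp _ _ _ _ _ _
  (fun wz : history xi s * Xi => noise (x s.+1 wz.1) (xi s wz.1) wz.2 0 i) _
  (fun w : history xi s.+1 => (w : history xi s, xi s.+1 w))).
  apply: measurable_noise => j; exact: measurable_iterates.
apply: measurable_fun_pair; first exact: historyS.
exact: (@history_measurable_xi _ _ _ _ xi s.+1 s.+1).
Qed.

Lemma measurable_residual S n i : measurable_fun setT
  (fun w : history xi (S + n) => residual S n w 0 i).
Proof.
have -> : (fun w : history xi (S + n) => residual S n w 0 i) =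
    (fun w => x (S + n).+1 w 0 i - xstar 0 i -
       eta (S + n).+1 * U (xi (S + n) w) 0 i - martingale_part S n w 0 i).
  apply/funext => w; rewrite /residual.
  by move: (x _ w) (martingale_part _ _ _) => y V; rewrite !mxE.
apply: measurable_funB; last exact: measurable_martingale_part.
apply: measurable_funB; last first.
  apply: measurable_funM => //; apply: (measurableT_comp (U_bounded i).1).
  exact: (@history_measurable_xi _ _ _ _ xi (S + n) (S + n)).
by apply: measurable_funB => //; exact: measurable_iterates.
Qed.

(** [H] cancels between the iterate and the noise. The new [U] in the noise nearly cancels the next
    corrector, leaving the difference of step sizes, and the term [c * eta * V] left over from the
    martingale part completes [c *: (x - xstar)]. *)
Lemma residualS S n w : let s := (S + n)%N in
  residual S n.+1 w =
  (1 - c * eta s.+1) *: residual S n w - (c * eta s.+1 ^+ 2) *: U (xi s w) -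
  eta s.+1 *: (drift (x s.+1 w) (xi s w) - c *: (x s.+1 w - xstar)) +
  (eta s.+1 - eta s.+2) *: U (xi s.+1 w).
Proof.
move=> s; rewrite /residual addnS -/s.
have -> : x s.+2 w = x s.+1 w - eta s.+1 *: H (x s.+1 w) (xi s.+1 w) by [].
have -> : martingale_part S n.+1 w = (1 - c * eta s.+1) *: martingale_part S n w
    - eta s.+1 *: noise (x s.+1 w) (xi s w) (xi s.+1 w) by [].
rewrite /noise; move: (drift _ _) (martingale_part S n w) => D V.
move: (x s.+1 w) => y.
move: (H _ _) (U _) (U _) => h u u'.
by apply/rowP => i; rewrite !mxE; ring.
Qed.

Lemma iterates_residual S n w : let s := (S + n)%N in
  x s.+1 w - xstar =
  residual S n w + eta s.+1 *: U (xi s w) + martingale_part S n w.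
Proof.
move=> s; rewrite /residual -/s.
move: (x s.+1 w) (U _) (martingale_part _ _ _) => y u V.
by apply/rowP => i; rewrite !mxE; ring.
Qed.

Definition lyapunov (lam : R) (S n : nat) (w : Omega) : R :=
  nrm (residual S n w) `^ p + lam * \sum_i `|martingale_part S n w 0 i| `^ p.

Let measurable_lift s (f : history xi s -> R) : measurable_fun setT f ->
  measurable_fun setT (fun w : Omega => f w).
Proof. by move=> mf; exact: (measurableT_comp mf (measurable_history mxi s)). Qed.

Lemma measurable_iterates_powR s :
  measurable_fun setT (fun w : Omega => nrm (x s w - xstar) `^ p).
Proof.
case: s => [|s]; first exact: (measurable_cst (nrm (x0 - xstar) `^ p)).
apply: (@measurable_lift s (fun w => nrm (x s.+1 w - xstar) `^ p)).
apply: (measurableT_comp (measurable_powR p)); apply: measurable_nrm => // i.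
have -> : (fun w : history xi s => (x s.+1 w - xstar) 0 i) =
    (fun w => x s.+1 w 0 i - xstar 0 i).
  by apply/funext => w; move: (x _ w) => y; rewrite !mxE.
by apply: measurable_funB => //; exact: measurable_iterates.
Qed.

Lemma measurable_residual_powR S n :
  measurable_fun setT (fun w : Omega => nrm (residual S n w) `^ p).
Proof.
apply: (@measurable_lift (S + n)).
apply: (measurableT_comp (measurable_powR p)); apply: measurable_nrm => // i.
exact: measurable_residual.
Qed.

Lemma measurable_martingale_powR S n i :
  measurable_fun setT (fun w : Omega => `|martingale_part S n w 0 i| `^ p).
Proof.
apply: (@measurable_lift (S + n)).
apply: (measurableT_comp (measurable_powR p)); apply: measurableT_comp => //.
exact: measurable_martingale_part.
Qed.

Lemma measurable_lyapunov lam S n : measurable_fun setT (lyapunov lam S n).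
Proof.
apply: measurable_funD; first exact: measurable_residual_powR.
apply: measurable_funM => //; apply: measurable_sum => i.
exact: measurable_martingale_powR.
Qed.

Lemma lyapunov_ge0 lam S n w : 0 <= lam -> 0 <= lyapunov lam S n w.
Proof.
by move=> l0; rewrite addr_ge0 ?powR_ge0// mulr_ge0// sumr_ge0.
Qed.

Let U_nrm : exists2 B, 0 <= B & forall y, nrm (U y) <= B.
Proof.
have [K K0 HK] := is_norm_le_coord nrmP.
exists (K * `|BU|); first by rewrite mulr_ge0.
move=> y; apply: HK => i; apply: (le_trans ((U_bounded i).2 y)).
exact: ler_norm.
Qed.

(** The constant is uniform over [lam >= 1], so it does not depend on the later choice of [lam]. *)
Lemma iterates_lyapunov_le : exists2 K, 0 <= K &
  forall lam S n w, 1 <= lam ->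
    nrm (x (S + n).+1 w - xstar) `^ p <=
    K * (lyapunov lam S n w + eta (S + n).+1 `^ (p / 2)).
Proof.
have [B B0 HB] := U_nrm.
have [K K0 HK] := is_norm_powR_le_sum nrmP (lt_trans (ltr0Sn R 1) p2).
have p0 : 0 <= p by have := p2; lra.
pose T := 2 `^ p : R.
have T0 : 0 <= T by exact: powR_ge0.
have T1 : 1 <= T by rewrite /T -[leLHS](powRr0 2) ler_powR//; lra.
have pow0 (a : R) : 0 <= a `^ p by exact: powR_ge0.
exists (T * T * (1 + B `^ p + K)).
  by rewrite mulr_ge0// ?mulr_ge0// !addr_ge0.
move=> lam S n w lam1; rewrite iterates_residual /lyapunov.
move: (residual S n w) (martingale_part S n w) (U _) (HB (xi (S + n) w)).
move=> r v u uB; have [eta0 eta1] := andP (eta01 (S + n).+1).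
move: (eta (S + n).+1) eta0 eta1 => e e0 e1.
have N0 := is_norm_ge0 nrmP.
have eB0 : 0 <= e * B by rewrite mulr_ge0// ltW.
have le1 : nrm (r + e *: u + v) <= nrm r + e * B + nrm v.
  apply: (le_trans (is_normD nrmP _ _)); rewrite lerD2r.
  apply: (le_trans (is_normD nrmP _ _)); rewrite lerD2l.
  by rewrite (is_normZ nrmP) gtr0_norm// ler_pM2l.
apply: (le_trans (le_powR p0 (N0 _) le1)).
apply: (le_trans (powRD_le p0 _ (N0 v))); first by rewrite addr_ge0.
rewrite -/T -!mulrA ler_wpM2l//.
have rB := powRD_le p0 (N0 r) eB0.
apply: (le_trans (lerD rB (HK v))).
rewrite powRM//; last exact: ltW.
have hE : e `^ p <= e `^ (p / 2).
  by apply: ger_powR; [rewrite e0|have := p2; lra].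
rewrite -/T; set s := \sum_i _.
have s0 : 0 <= s by exact: sumr_ge0.
have E0 : 0 <= e `^ (p / 2) by exact: powR_ge0.
have Bp0 := pow0 B; have r0 := pow0 (nrm r).
move: (nrm r `^ p) (e `^ p) (e `^ (p / 2)) (B `^ p) hE E0 Bp0 r0.
move=> rp ep eq Bp hE E0 Bp0 r0.
apply: (@le_trans _ _ (T * ((rp + eq * Bp) + K * s))).
  rewrite [leRHS]mulrDr; apply: lerD; last by rewrite ler_peMl// mulr_ge0.
  by rewrite ler_wpM2l// lerD2l ler_wpM2r.
rewrite ler_wpM2l//.
have ls : s <= lam * s by rewrite ler_peMl.
apply: (@le_trans _ _ (rp + eq * Bp + K * (lam * s))).
  by rewrite lerD2l ler_wpM2l.
have : 0 <= lam * s by apply: le_trans ls.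
move: (lam * s) => q q0; nra.
Qed.

Lemma lyapunov_step : exists alpha lam K,
  [/\ 0 < alpha <= c, 1 <= lam, 0 <= K & forall S n,
  let e := eta (S + n).+1 in
  c * e <= 1 -> 0 <= e - eta (S + n).+2 <= e ^+ 2 ->
  (\int[Pr]_w (lyapunov lam S n.+1 w)%:E <=
   \int[Pr]_w ((1 - alpha * e) * lyapunov lam S n w +
      K * e `^ (1 + p / 2) * (1 + lyapunov lam S n w))%:E)%E].
Proof.
have [B B0 HB] := U_nrm.
have p0 : 0 < p by have := p2; lra.
have [K1 K10 HK1] := residual_step nrmP p2 c0 gamma01 B0.
have [K2 K20 HK2] := iterates_lyapunov_le.
have [K3 K30 HK3] := noise_step.
have [Kn Kn0 HKn] := is_norm_powR_le_sum nrmP p0.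
have [g0 g1] := andP gamma01.
pose a := c * (1 - gamma).
have a0 : 0 < a by rewrite mulr_gt0// subr_gt0.
have ac : a <= c by rewrite ler_piMr ?(ltW c0)//; lra.
(* With this value the feed [K1 * Kn * e] of the martingale part into the residual is at most
   [c / 4 * e * lam]. The martingale part contracts at rate [c / 2], so a rate [c / 4] remains;
   [alpha] is the smaller of this and the residual's rate [a]. *)
pose lam := 1 + 4 * K1 * Kn / c.
have lam1 : 1 <= lam.
  by rewrite lerDl; apply: divr_ge0; [rewrite !mulr_ge0|exact: ltW].
pose alpha := Num.min a (c / 4).
have alpha_a : alpha <= a by rewrite ge_min lexx.
have alpha_c : alpha <= c / 4 by rewrite ge_min lexx orbT.
pose K := K1 + lam * (d%:R * (K3 * (1 + K2))).
have lam0 : 0 <= lam by lra.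
have K0 : 0 <= K by rewrite addr_ge0// !mulr_ge0// addr_ge0.
exists alpha, lam, K; split => //.
  by rewrite lt_min a0 (le_trans alpha_a)//= andbT; have := c0; lra.
move=> S n e ce de.
have [e0 e1] := andP (eta01 (S + n).+1); rewrite -/e in e0 e1.
have q0 : 0 < p / 2 by lra.
have eW : e `^ (1 + p / 2) = e * e `^ (p / 2).
  by rewrite powRD_ge0 ?powRr1//; lra.
pose Sig w := \sum_i `|martingale_part S n w 0 i| `^ p.
have Sig0 w : 0 <= Sig w by apply: sumr_ge0 => i _; exact: powR_ge0.
pose r w := nrm (residual S n w) `^ p.
have r0 w : 0 <= r w by exact: powR_ge0.
pose Dx w := nrm (x (S + n).+1 w - xstar) `^ p.
have Dx0 w : 0 <= Dx w by exact: powR_ge0.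
have E0 : 0 <= e `^ (p / 2) by exact: powR_ge0.
have E1 : e `^ (p / 2) <= 1.
  by rewrite -[leRHS](powRr0 e); apply: ger_powR; [rewrite e0|exact: ltW].
pose f w := (1 - a * e) * r w + K1 * e * (Kn * Sig w + e `^ (p / 2)).
have ae : a * e <= 1 by apply: le_trans ce; rewrite ler_pM2r.
have f0 w : 0 <= f w.
  rewrite addr_ge0// mulr_ge0//; first by rewrite subr_ge0.
    by rewrite mulr_ge0// ltW.
  by rewrite addr_ge0// mulr_ge0.
have mr : measurable_fun setT r by exact: measurable_residual_powR.
have mSig : measurable_fun setT Sig.
  by apply: measurable_sum => i; exact: measurable_martingale_powR.
have mDx : measurable_fun setT Dx by exact: measurable_iterates_powR.
have mf : measurable_fun setT f.
  apply: measurable_funD; first exact: measurable_funM.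
  apply: measurable_funM => //; apply: measurable_funD => //.
  exact: measurable_funM.
pose g i w := (1 - c / 2 * e) * `|martingale_part S n w 0 i| `^ p +
  K3 * e `^ (1 + p / 2) * (1 + Dx w).
have g0' i w : 0 <= g i w.
  rewrite addr_ge0// mulr_ge0 ?powR_ge0//.
  - have : 0 < c * e by rewrite mulr_gt0.
    by have := ce; lra.
  - by rewrite mulr_ge0// powR_ge0.
  - by rewrite addr_ge0.
have mg i : measurable_fun setT (g i).
  apply: measurable_funD; apply: measurable_funM => //.
    exact: measurable_martingale_powR.
  exact: measurable_funD.
have res w : nrm (residual S n.+1 w) `^ p <= f w.
  rewrite residualS -/e /f.
  apply: le_trans.
    apply: (HK1 e (eta (S + n).+2) _ (martingale_part S n w)) => //.
    - by rewrite e0.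
    - by have /= <- := iterates_residual S n w; exact: contraction.
  by rewrite lerD2l ler_wpM2l ?mulr_ge0 ?(ltW e0)// lerD2r.
apply: (@le_trans _ _
  (\int[Pr]_w (f w)%:E + lam%:E * \sum_i \int[Pr]_w (g i w)%:E)%E).
  rewrite /lyapunov; under eq_integral do rewrite EFinD.
  rewrite ge0_integralD//; last 4 first.
  - by move=> w _; rewrite lee_fin powR_ge0.
  - by apply/measurable_EFinP; exact: measurable_residual_powR.
  - by move=> w _; rewrite lee_fin mulr_ge0// sumr_ge0.
  - apply/measurable_EFinP; apply: measurable_funM => //.
    by apply: measurable_sum => i; exact: measurable_martingale_powR.
  apply: leeD.
    apply: ge0_le_integral => //.
    - by move=> w _; rewrite lee_fin powR_ge0.
    - by apply/measurable_EFinP; exact: measurable_residual_powR.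
    - exact/measurable_EFinP.
    - by move=> w _; rewrite lee_fin.
  under eq_integral do rewrite EFinM.
  rewrite ge0_integralZl//; last 2 first.
  - apply/measurable_EFinP.
    by apply: measurable_sum => i; exact: measurable_martingale_powR.
  - by move=> w _; rewrite lee_fin sumr_ge0.
  apply: lee_wpmul2l; first by rewrite lee_fin.
  under eq_integral do rewrite -sumEFin.
  rewrite ge0_integral_sum//; last first.
    by move=> i; apply/measurable_EFinP; exact: measurable_martingale_powR.
  apply: lee_sum => i _.
  have mx j : measurable_fun setT
      (fun w : history xi (S + n) => x (S + n).+1 w 0 j).
    exact: measurable_iterates.
  have mV j : measurable_fun setT
      (fun w : history xi (S + n) => martingale_part S n w 0 j).
    exact: measurable_martingale_part.
  have := HK3 (S + n)%N _ _ e i mx mV.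
  rewrite e0 e1 => /(_ isT ce) h.
  apply: le_trans h; rewrite le_eqVlt; apply/orP; left; apply/eqP.
  apply: eq_integral => w _; congr ((`|_| `^ p)%:E).
  rewrite /= -/e; move: (noise _ _ _) (martingale_part _ _ _) => N V.
  by rewrite !mxE.
rewrite -ge0_integral_sum//; last 2 first.
- by move=> i; exact/measurable_EFinP.
- by move=> i w _; rewrite lee_fin.
have msum : measurable_fun setT (fun w => \sum_i (g i w)%:E)%E.
  by apply: emeasurable_sum => i; exact/measurable_EFinP.
have sum0 w : (0 <= \sum_i (g i w)%:E)%E.
  by apply: sume_ge0 => i _; rewrite lee_fin.
rewrite -ge0_integralZl//.
have mlsum : measurable_fun setT (fun w => lam%:E * \sum_i (g i w)%:E)%E.
  exact: measurable_funeM.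
rewrite -ge0_integralD//; last 3 first.
- by move=> w _; rewrite lee_fin.
- exact/measurable_EFinP.
- by move=> w _; rewrite mule_ge0.
have mly : measurable_fun setT (fun w => (1 - alpha * e) * lyapunov lam S n w +
      K * e `^ (1 + p / 2) * (1 + lyapunov lam S n w)).
  apply: measurable_funD; apply: measurable_funM => //.
    exact: measurable_lyapunov.
  by apply: measurable_funD => //; exact: measurable_lyapunov.
apply: ge0_le_integral => //.
- by move=> w _; rewrite adde_ge0 ?lee_fin// mule_ge0.
- by apply: emeasurable_funD => //; exact/measurable_EFinP.
- exact/measurable_EFinP.
move=> w _; rewrite sumEFin -EFinM -EFinD lee_fin.
rewrite /g big_split/= -mulr_sumr sumr_const card_ord -/(Sig w) /f.
have := HK2 lam S n w lam1; rewrite -/(Dx w) -/e.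
have -> : lyapunov lam S n w = r w + lam * Sig w by [].
rewrite eW -(mulr_natl _ d).
move: (r w) (Sig w) (Dx w) (r0 w) (Sig0 w) (Dx0 w) => rr s D rr0 s0 D0 HD.
move: (e `^ (p / 2)) E0 E1 HD => E E0 E1 HD.
have ly0 : 0 <= rr + lam * s by rewrite addr_ge0// mulr_ge0.
have D1 : 1 + D <= (1 + K2) * (1 + (rr + lam * s)).
  have KE : K2 * E <= K2 by rewrite ler_piMr.
  by move: HD; move: (rr + lam * s) ly0 => y y0; lra.
have h1 : K1 * e * (Kn * s) <= c / 4 * e * (lam * s).
  have -> : K1 * e * (Kn * s) = c / 4 * e * ((4 * K1 * Kn / c) * s).
    by field; rewrite gt_eqF.
  rewrite ler_wpM2l ?mulr_ge0 ?divr_ge0// ?(ltW c0) ?(ltW e0)//.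
  by rewrite ler_wpM2r// /lam lerDr.
have h2 : K1 * e * E <= K1 * (e * E) * (1 + (rr + lam * s)).
  by rewrite mulrA ler_peMr ?lerDl// !mulr_ge0// ltW.
have h3 : lam * (d%:R * (K3 * (e * E) * (1 + D))) <=
   lam * (d%:R * (K3 * (1 + K2))) * (e * E) * (1 + (rr + lam * s)).
  have -> : lam * (d%:R * (K3 * (1 + K2))) * (e * E) * (1 + (rr + lam * s)) =
    lam * (d%:R * (K3 * (e * E) * ((1 + K2) * (1 + (rr + lam * s))))) by ring.
  rewrite ler_wpM2l// ler_wpM2l// ler_wpM2l//.
  by rewrite !mulr_ge0// ltW.
have h4 : alpha * e * rr <= a * e * rr.
  by rewrite ler_wpM2r// ler_wpM2r// ltW.
have h5 : alpha * e * (lam * s) <= c / 4 * e * (lam * s).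
  by rewrite ler_wpM2r ?mulr_ge0// ler_wpM2r// ltW.
move: h1 h2 h3 h4 h5; rewrite /K.
lra.
Qed.

(** A qualitative bound from linear growth, with constants that may grow with [t]: it starts the
    induction at time [S] and covers the times before. *)
Lemma iterates_moment_finite (M Bg : R) (gbar : Xi -> R) :
  0 < M -> (forall y, 0 <= gbar y) -> measurable_fun setT gbar ->
  (forall y z, nrm (H y z) <= M * (nrm y + gbar z)) ->
  (forall t, (\int[Pr]_w ((`|gbar (xi t w)|) `^ p)%:E <= Bg%:E)%E) ->
  forall t, (\int[Pr]_w (nrm (x t w - xstar) `^ p)%:E < +oo)%E.
Proof.
move=> M0 gbar0 mgbar HM gB; have p0 : 0 <= p by have := p2; lra.
have M0' := ltW M0.
have N0 := is_norm_ge0 nrmP.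
have pow0 (a : R) : 0 <= a `^ p by exact: powR_ge0.
elim=> [|t IHt].
  rewrite -[ltLHS]/(\int[Pr]_w cst ((nrm (x0 - xstar) `^ p)%:E) w)%E.
  rewrite integral_cst// [X in (_ * X)%E](_ : _ = 1%E) ?mule1 ?ltry//.
  exact: probability_setT.
pose T := 2 `^ p : R.
have T0 : 0 <= T by exact: pow0.
pose A := T * (1 + M) `^ p.
pose B := T * (T * (M * nrm xstar) `^ p).
pose C := T * (T * M `^ p).
have A0 : 0 <= A by rewrite mulr_ge0.
have B0 : 0 <= B by rewrite mulr_ge0// mulr_ge0.
have C0 : 0 <= C by rewrite mulr_ge0// mulr_ge0.
have mg : measurable_fun setT (fun w => `|gbar (xi t w)| `^ p).
  apply: (measurableT_comp (measurable_powR p)); apply: measurableT_comp => //.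
  exact: measurableT_comp.
have mx := measurable_iterates_powR t.
have pt w : nrm (x t.+1 w - xstar) `^ p <=
    A * nrm (x t w - xstar) `^ p + (B + C * `|gbar (xi t w)| `^ p).
  have -> : x t.+1 w - xstar =
      (x t w - xstar) - eta t *: H (x t w) (xi t w) by rewrite /= addrAC.
  have [e0 e1] := andP (eta01 t); move: (eta t) e0 e1 => e e0 e1.
  rewrite (ger0_norm (gbar0 _)).
  move: (x t w) (xi t w) => y z; set a := nrm (y - xstar).
  have le1 : nrm (y - xstar - e *: H y z) <=
      (1 + M) * a + (M * nrm xstar + M * gbar z).
    apply: (le_trans (is_normD nrmP _ _)).
    rewrite (is_normN nrmP) (is_normZ nrmP) gtr0_norm//.
    have yle : nrm y <= a + nrm xstar.
      by rewrite -[y in leLHS](subrK xstar) is_normD.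
    have h1 : nrm (H y z) <= M * (a + nrm xstar + gbar z).
      by apply: (le_trans (HM y z)); rewrite ler_wpM2l// lerD2r.
    have h2 : e * nrm (H y z) <= nrm (H y z) by rewrite ler_piMl.
    by rewrite -/a; lra.
  have a0 : 0 <= a by exact: N0.
  have q1 : 0 <= (1 + M) * a by rewrite mulr_ge0// addr_ge0.
  have q2 : 0 <= M * nrm xstar by rewrite mulr_ge0.
  have q3 : 0 <= M * gbar z by rewrite mulr_ge0.
  apply: (le_trans (le_powR p0 (N0 _) le1)).
  apply: (le_trans (powRD_le p0 q1 (addr_ge0 q2 q3))).
  have -> : A * a `^ p = T * ((1 + M) * a) `^ p.
    by rewrite powRM ?addr_ge0// /A mulrA.
  have -> : C * gbar z `^ p = T * (T * (M * gbar z) `^ p).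
    by rewrite powRM// /C !mulrA.
  rewrite [leLHS]mulrDr lerD2l /B -[leRHS]mulrDr; apply: ler_wpM2l => //.
  by rewrite -[leRHS]mulrDr; exact: (powRD_le p0 q2 q3).
apply: (@le_lt_trans _ _ (\int[Pr]_w (A%:E * (nrm (x t w - xstar) `^ p)%:E +
   (B%:E + C%:E * (`|gbar (xi t w)| `^ p)%:E)))%E).
  apply: ge0_le_integral => //.
  - by move=> w _; rewrite lee_fin.
  - by apply/measurable_EFinP; exact: measurable_iterates_powR.
  - apply: emeasurable_funD.
      by apply: measurable_funeM; exact/measurable_EFinP.
    by apply: emeasurable_funD => //; apply: measurable_funeM; exact/measurable_EFinP.
  - by move=> w _; rewrite -!EFinM -!EFinD lee_fin.
have mEx : measurable_fun setT (fun w => (nrm (x t w - xstar) `^ p)%:E).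
  exact/measurable_EFinP.
have mEg : measurable_fun setT (fun w => (`|gbar (xi t w)| `^ p)%:E).
  exact/measurable_EFinP.
have mAx := measurable_funeM A%:E mEx.
have mCg := measurable_funeM C%:E mEg.
have mBCg : measurable_fun setT
    (fun w => B%:E + C%:E * (`|gbar (xi t w)| `^ p)%:E)%E.
  exact: emeasurable_funD.
have Ax0 w : (0 <= A%:E * (nrm (x t w - xstar) `^ p)%:E)%E.
  by rewrite -EFinM lee_fin mulr_ge0.
have Cg0 w : (0 <= C%:E * (`|gbar (xi t w)| `^ p)%:E)%E.
  by rewrite -EFinM lee_fin mulr_ge0.
have BCg0 w : (0 <= B%:E + C%:E * (`|gbar (xi t w)| `^ p)%:E)%E.
  by apply: adde_ge0 => //; rewrite lee_fin.
have x0' w : (0 <= (nrm (x t w - xstar) `^ p)%:E)%E by rewrite lee_fin.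
have g0' w : (0 <= (`|gbar (xi t w)| `^ p)%:E)%E by rewrite lee_fin.
rewrite ge0_integralD// (ge0_integralZl _ _ mEx)// ge0_integralD//.
rewrite (ge0_integralZl _ _ mEg)//.
apply: lte_add_pinfty; first by apply: lte_mul_pinfty.
apply: lte_add_pinfty.
  rewrite integral_cst// [X in (_ * X)%E](_ : _ = 1%E) ?mule1 ?ltry//.
  exact: probability_setT.
apply: lte_mul_pinfty => //; apply: (le_lt_trans (gB t)).
exact: ltry.
Qed.

(** The contraction [alpha] is spent in three shares: a quarter on the multiplicative error
    [K * e n ^ (p / 2)], a quarter on the source term, and the remaining half on the decrease of
    [e n ^ (p / 2)] itself. *)
Lemma iterates_moment_rate :
  (forall eps, 0 < eps -> exists N, forall t, (N <= t)%N -> eta t <= eps) ->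
  (forall eps, 0 < eps -> exists N, forall t, (N <= t)%N ->
     0 <= eta t - eta t.+1 <= eps * eta t ^+ 2) ->
  (forall t, (\int[Pr]_w (nrm (x t w - xstar) `^ p)%:E < +oo)%E) ->
  exists2 C, 0 <= C & forall t,
    (\int[Pr]_w (nrm (x t w - xstar) `^ p)%:E <= (C * eta t `^ (p / 2))%:E)%E.
Proof.
move=> eta_small eta_reg xfin.
have q0 : 0 < p / 2 by have := p2; lra.
have q1 : 1 <= p / 2 by have := p2; lra.
have [alpha [lam [K [/andP[al0 alc] lam1 K0 step]]]] := lyapunov_step.
have [K2 K20 HK2] := iterates_lyapunov_le.
have lam0 : 0 <= lam by lra.
have pow0 (a : R) : 0 <= a `^ p by exact: powR_ge0.
(* The second value makes [2 * (p / 2) * eps] at most [alpha / 2], the allowed relative decrease;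
   [2^-1] is the range of [powR_1B_ge]. *)
pose eps := Num.min 2^-1 (alpha / (4 * (p / 2))).
have eps0 : 0 < eps by rewrite lt_min invr_gt0 ltr0n divr_gt0// mulr_gt0.
have eps_half : eps <= 2^-1 by rewrite ge_min lexx.
have eps_alpha : eps <= alpha / (4 * (p / 2)) by rewrite ge_min lexx orbT.
(* [c^-1] ensures [c * e n <= 1]; the other value gives [K * e n <= alpha / 4], with [K + 1] in the
   denominator because [K] may be 0. *)
pose del := Num.min c^-1 (alpha / (4 * (K + 1))).
have K1 : 0 < K + 1 by lra.
have del0 : 0 < del by rewrite lt_min invr_gt0 c0 divr_gt0// mulr_gt0.
have del_c : del <= c^-1 by rewrite ge_min lexx.
have del_K : del <= alpha / (4 * (K + 1)) by rewrite ge_min lexx orbT.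
have [N1 HN1] := eta_small del del0.
have [N2 HN2] := eta_reg eps eps0.
pose S := maxn N1 N2.
pose e n := eta (S + n).+1.
have e0 n : 0 < e n by case/andP: (eta01 (S + n).+1).
have e1 n : e n <= 1 by case/andP: (eta01 (S + n).+1).
have eq0 n : 0 < e n `^ (p / 2) by exact: powR_gt0.
have edel n : e n <= del.
  by apply: HN1; rewrite (leq_trans (leq_maxl _ N2))// leqW// leq_addr.
have ereg n : 0 <= e n - eta (S + n).+2 <= eps * e n ^+ 2.
  by apply: HN2; rewrite (leq_trans (leq_maxr N1 _))// leqW// leq_addr.
have ce n : c * e n <= 1.
  rewrite -(mulfV (lt0r_neq0 c0)) ler_pM2l//.
  exact: le_trans del_c.
have Ke n : K * e n `^ (p / 2) <= alpha / 4.
  have : K * e n <= alpha / 4.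
    apply: (@le_trans _ _ ((K + 1) * e n)).
      by rewrite ler_pM2r// lerDl.
    have -> : alpha / 4 = (K + 1) * (alpha / (4 * (K + 1))).
      by field; rewrite gt_eqF.
    by rewrite ler_pM2l// (le_trans (edel n)).
  apply: le_trans; rewrite ler_wpM2l//.
  by apply: ge1r_powR; rewrite ?e0 ?e1.
have next n : (1 - alpha / 2 * e n) * e n `^ (p / 2) <= e n.+1 `^ (p / 2).
  have [d0 d1] := andP (ereg n).
  have ee : 0 <= eps * e n <= 2^-1.
    apply/andP; split; first by rewrite mulr_ge0// ltW.
    by apply: (le_trans _ eps_half); rewrite ler_piMr// ltW.
  apply: (@le_trans _ _ ((1 - 2 * (p / 2) * (eps * e n)) * e n `^ (p / 2))).
    rewrite ler_pM2r// lerD2l lerN2 (mulrA _ eps) ler_pM2r//.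
    have -> : alpha / 2 = 2 * (p / 2) * (alpha / (4 * (p / 2))).
      by field; rewrite gt_eqF//; have := p2; lra.
    by rewrite ler_pM2l// mulr_gt0.
  apply: (@le_trans _ _ ((1 - eps * e n) `^ (p / 2) * e n `^ (p / 2))).
    by rewrite ler_pM2r// powR_1B_ge// ltW.
  have [ee0 ee1] := andP ee.
  have u0 : 0 <= 1 - eps * e n by lra.
  rewrite -powRM//; last exact: ltW.
  apply: le_powR; [exact: ltW|by rewrite mulr_ge0// ltW|].
  by rewrite /e addnS; move: d1; rewrite -/(e n); lra.
have lfin : (\int[Pr]_w (lyapunov lam S 0 w)%:E < +oo)%E.
  have [B B0 HB] := U_nrm.
  have p0 : 0 <= p by have := p2; lra.
  have pt w : lyapunov lam S 0 w <=
      2 `^ p * (nrm (x (S + 0).+1 w - xstar) `^ p + B `^ p).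
    rewrite /lyapunov [X in _ + lam * X]big1 => [|i _]; last first.
      by rewrite mxE normr0 powR0// gt_eqF//; have := p2; lra.
    rewrite mulr0 addr0; apply: le_trans (powRD_le p0 (is_norm_ge0 nrmP _) B0).
    apply: le_powR => //; first exact: is_norm_ge0.
    rewrite /residual [martingale_part S 0 w]/= subr0.
    apply: (le_trans (is_normD nrmP _ _)); rewrite lerD2l (is_normN nrmP).
    rewrite (is_normZ nrmP) gtr0_norm; last exact: e0.
    by apply: le_trans (HB (xi (S + 0) w)); rewrite ler_piMl ?is_norm_ge0//; exact: e1.
  apply: (@le_lt_trans _ _ (\int[Pr]_w ((2 `^ p)%:E *
      ((nrm (x (S + 0).+1 w - xstar) `^ p)%:E + (B `^ p)%:E)))%E).
    apply: ge0_le_integral => //.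
    - by move=> w _; rewrite lee_fin lyapunov_ge0.
    - by apply/measurable_EFinP; exact: measurable_lyapunov.
    - apply: measurable_funeM; apply: emeasurable_funD => //.
      by apply/measurable_EFinP; exact: measurable_iterates_powR.
    - by move=> w _; rewrite -EFinD -EFinM lee_fin.
  have mx : measurable_fun setT
      (fun w => (nrm (x (S + 0).+1 w - xstar) `^ p)%:E).
    by apply/measurable_EFinP; exact: measurable_iterates_powR.
  rewrite ge0_integralZl//; last 2 first.
  - exact: emeasurable_funD.
  - by move=> w _; rewrite adde_ge0// lee_fin.
  rewrite ge0_integralD//; last 2 first.
  - by move=> w _; rewrite lee_fin.
  - by move=> w _; rewrite lee_fin.
  apply: lte_mul_pinfty => //; apply: lte_add_pinfty; first exact: xfin.
  rewrite integral_cst// [X in (_ * X)%E](_ : _ = 1%E) ?mule1 ?ltry//.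
  exact: probability_setT.
have [C0 C00 HC0] : exists2 C, 0 <= C &
    (\int[Pr]_w (lyapunov lam S 0 w)%:E <= (C * e 0%N `^ (p / 2))%:E)%E.
  move: lfin; set I := (\int[Pr]_w _)%E => lfin.
  have I0 : (0 <= I)%E by apply: integral_ge0 => w _; rewrite lee_fin lyapunov_ge0.
  have If : I \is a fin_num by rewrite ge0_fin_numE.
  exists (fine I / e 0%N `^ (p / 2)); first by rewrite divr_ge0 ?fine_ge0// ltW.
  by rewrite divfK ?gt_eqF// fineK.
(* [C0] covers the start, and [4 * K / alpha] bounds the source [K] by [alpha / 4 * C]. *)
pose C := C0 + 4 * K / alpha.
have KC : 0 <= 4 * K / alpha by rewrite divr_ge0 ?mulr_ge0// ltW.
have C'0 : 0 <= C by rewrite addr_ge0.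
have bound n : (\int[Pr]_w (lyapunov lam S n w)%:E <= (C * e n `^ (p / 2))%:E)%E.
  elim: n => [|n IHn].
    by apply: (le_trans HC0); rewrite lee_fin ler_pM2r// lerDl.
  have [d0 d1] := andP (ereg n).
  have d' : 0 <= e n - eta (S + n).+2 <= e n ^+ 2.
    rewrite d0/= (le_trans d1)// ler_piMl ?sqr_ge0//.
    by rewrite (le_trans eps_half)// invf_le1// ler1n.
  apply: (le_trans (step S n (ce n) d')); rewrite -/(e n).
  have eW : e n `^ (1 + p / 2) = e n * e n `^ (p / 2).
    by rewrite powRD_ge0 ?powRr1//; [exact: ltW|exact: ltW].
  pose k1 := 1 - alpha * e n + K * e n `^ (1 + p / 2).
  have ae : alpha * e n <= 1.
    by apply: le_trans (ce n); rewrite ler_pM2r.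
  have k10 : 0 <= k1.
    by rewrite addr_ge0 ?subr_ge0// mulr_ge0// powR_ge0.
  have k2 : 0 <= K * e n `^ (1 + p / 2) by rewrite mulr_ge0// powR_ge0.
  have -> : (\int[Pr]_w ((1 - alpha * e n) * lyapunov lam S n w +
      K * e n `^ (1 + p / 2) * (1 + lyapunov lam S n w))%:E =
      \int[Pr]_w (k1%:E * (lyapunov lam S n w)%:E +
                  (K * e n `^ (1 + p / 2))%:E))%E.
    apply: eq_integral => w _; rewrite -EFinM -EFinD; congr EFin.
    by rewrite /k1; ring.
  have mly : measurable_fun setT (fun w => (lyapunov lam S n w)%:E).
    by apply/measurable_EFinP; exact: measurable_lyapunov.
  rewrite ge0_integralD//; last 2 first.
  - by move=> w _; rewrite -EFinM lee_fin mulr_ge0// lyapunov_ge0.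
  - exact: measurable_funeM.
  rewrite ge0_integralZl//; last by move=> w _; rewrite lee_fin lyapunov_ge0.
  rewrite integral_cst// [X in (_ + _ * X)%E](_ : _ = 1%E); last exact: probability_setT.
  rewrite mule1.
  apply: (@le_trans _ _ (k1%:E * (C * e n `^ (p / 2))%:E +
     (K * e n `^ (1 + p / 2))%:E)%E).
    by rewrite leeD2r// lee_wpmul2l// lee_fin.
  rewrite -EFinM -EFinD lee_fin.
  apply: (@le_trans _ _ (C * ((1 - alpha / 2 * e n) * e n `^ (p / 2)))); last first.
    by rewrite ler_wpM2l.
  rewrite /k1 eW; have := Ke n; have := eq0 n; have := e0 n.
  have : 4 * K <= alpha * C.
    have -> : alpha * C = alpha * C0 + 4 * K.
      by rewrite /C mulrDr mulrCA mulfV ?mulr1// gt_eqF.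
    by rewrite lerDr mulr_ge0// ltW.
  move: (e n) (e n `^ (p / 2)) => u E KC' u0 E0 KE.
  have uE : 0 < u * E by rewrite mulr_gt0.
  have h1 : 4 * K * (u * E) <= alpha * C * (u * E) by rewrite ler_pM2r.
  have h2 : C * (u * E) * (K * E) <= C * (u * E) * (alpha / 4).
    by rewrite ler_wpM2l// mulr_ge0// ltW.
  lra.
(* The finitely many times up to [S] are handled by summing their normalised moments, which
   dominates each of them. *)
pose early t := fine (\int[Pr]_w (nrm (x t w - xstar) `^ p)%:E) / eta t `^ (p / 2).
have etaq t : 0 < eta t `^ (p / 2) by rewrite powR_gt0//; case/andP: (eta01 t).
have I0 t : (0 <= \int[Pr]_w (nrm (x t w - xstar) `^ p)%:E)%E.
  by apply: integral_ge0 => w _; rewrite lee_fin.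
have early0 t : 0 <= early t by rewrite divr_ge0 ?fine_ge0// ltW.
have late0 : 0 <= K2 * (C + 1) by rewrite mulr_ge0// addr_ge0.
exists (\sum_(t < S.+1) early t + K2 * (C + 1)).
  by rewrite addr_ge0// sumr_ge0.
move=> t; have [tS|St] := ltnP t S.+1.
  apply: (@le_trans _ _ (early t * eta t `^ (p / 2))%:E).
    by rewrite divfK ?gt_eqF// fineK// ge0_fin_numE.
  rewrite lee_fin ler_pM2r// (bigD1 (Ordinal tS))//= -addrA lerDl addr_ge0//.
  by rewrite sumr_ge0.
have -> : t = (S + (t - S.+1)).+1 by rewrite -addSn subnKC.
move: (t - S.+1)%N => n; rewrite -/(e n).
apply: (@le_trans _ _ (K2 * (C + 1) * e n `^ (p / 2))%:E); last first.
  by rewrite lee_fin ler_pM2r// lerDr sumr_ge0.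
have mly : measurable_fun setT (fun w => (lyapunov lam S n w)%:E).
  by apply/measurable_EFinP; exact: measurable_lyapunov.
apply: (@le_trans _ _ (\int[Pr]_w (K2%:E * ((lyapunov lam S n w)%:E +
    (e n `^ (p / 2))%:E)))%E).
  apply: ge0_le_integral => //.
  - by move=> w _; rewrite lee_fin.
  - by apply/measurable_EFinP; exact: measurable_iterates_powR.
  - by apply: measurable_funeM; exact: emeasurable_funD.
  - by move=> w _; rewrite -EFinD -EFinM lee_fin; exact: HK2.
have ly0 w : (0 <= (lyapunov lam S n w)%:E)%E by rewrite lee_fin lyapunov_ge0.
rewrite ge0_integralZl//; last 2 first.
- exact: emeasurable_funD.
- by move=> w _; rewrite adde_ge0// lee_fin ltW.
rewrite ge0_integralD//; last by move=> w _; rewrite lee_fin ltW.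
rewrite integral_cst// [X in (_ + _ * X)%E](_ : _ = 1%E); last exact: probability_setT.
rewrite mule1 -mulrA EFinM lee_wpmul2l ?lee_fin// mulrDl mul1r EFinD leeD2r//.
Qed.

End recursion.

End noise.

(** * Passage between moments and norms, and the conclusion *)

Lemma poweR_inv_le (R : realType) (I : \bar R) (p b : R) : 0 < p ->
  (0 <= I)%E -> 0 <= b -> (poweR I p^-1 <= b%:E)%E -> (I <= (b `^ p)%:E)%E.
Proof.
move=> p0 + b0; case: I => [x||]//=.
  rewrite !lee_fin => x0 h.
  rewrite -[x in leLHS](powRr1 x0) -(mulVf (lt0r_neq0 p0)) powRrM.
  by apply: le_powR; [exact: ltW|exact: powR_ge0|].
by move=> _; rewrite invr_eq0 gt_eqF.
Qed.

Lemma poweR_le_inv (R : realType) (I : \bar R) (p b : R) : 0 < p ->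
  (0 <= I)%E -> 0 <= b -> (I <= (b `^ p)%:E)%E -> (poweR I p^-1 <= b%:E)%E.
Proof.
move=> p0 + b0; case: I => [x||]//=; rewrite !lee_fin => x0 h.
rewrite -[b in leRHS](powRr1 b0) -(mulfV (lt0r_neq0 p0)) powRrM.
by apply: le_powR; rewrite ?invr_ge0 ?(ltW p0).
Qed.

Theorem theorem2
  (R : realType) (d : nat)
  (nrm : 'rV[R]_d -> R)
  (dX : measure_display) (Xi : measurableType dX)
  (k : R.-pker Xi ~> Xi) (pi : probability Xi R)
  (dO : measure_display) (Omega : measurableType dO) (Pr : probability Omega R)
  (xi : nat -> Omega -> Xi)
  (H : 'rV[R]_d -> Xi -> 'rV[R]_d)
  (xstar x0 : 'rV[R]_d) (eta : nat -> R)
  (p sigma LH kappa rho gamma c M : R) (gbar : Xi -> R) :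
  (* setting *)
  is_norm nrm ->
  markov_chain Pr k xi ->
  jointly_measurable H ->
  (forall i : 'I_d, pi.-integrable setT (fun y => (H xstar y 0 i)%:E)) ->
  (forall i : 'I_d, Rintegral pi setT (fun y => H xstar y 0 i) = 0) ->
  (* (A2) *)
  2 < p -> 0 < sigma ->
  (exists B : R, forall t,
     (poweR (\int[Pr]_w ((nrm (H xstar (xi t w))) `^ p)%:E) p^-1 <= B%:E)%E) ->
  (forall y (i : 'I_d), (k y).-integrable setT (fun y' => (H xstar y' 0 i)%:E)) ->
  (forall y, nrm (Pvec k (H xstar) y) <= sigma) ->
  (* (A3) *)
  (forall x y z,
     (poweR (\int[k z]_y' ((nrm (H x y' - H y y')) `^ p)%:E) p^-1
       <= (LH * nrm (x - y))%:E)%E) ->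
  (* (A4) *)
  stationary k pi ->
  (forall mu : probability Xi R, stationary k mu ->
     forall A, measurable A -> mu A = pi A) ->
  expR 1 <= kappa -> 0 <= rho < 1 ->
  (forall y t, (dTV (Piter k t y) pi <= (kappa * rho ^+ t / 2)%:E)%E) ->
  (* (A5) *)
  (forall t, 0 < eta t <= 1) ->
  (forall t, eta t.+1 <= eta t) ->
  eta @ \oo --> 0 ->
  (fun t => eta t * (ln t%:R) ^+ 2) @ \oo --> 0 ->
  (forall t, t%:R * eta t <= t.+1%:R * eta t.+1) ->
  (fun t => t%:R * eta t) @ \oo --> +oo ->
  (fun t => (eta t.-1 - eta t) / eta t.-1) =o_\oo (fun t => eta t.-1) ->
  cvg ((fun n => \sum_(1 <= t < n) (ln t%:R / Num.sqrt t%:R * eta t)) @ \oo) ->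
  (exists C : R, forall T : nat, (1 <= T)%N ->
     \sum_(0 <= t < T.+1) eta t / (T%:R * eta T) <= C) ->
  (* (A7) *)
  0 <= gamma < 1 -> 0 < c ->
  (forall x y z,
     nrm (Pvec k (fun y' => H x y' - H y y') z - c *: (x - y)) <= gamma * c * nrm (x - y)) ->
  (* (A8) *)
  0 < M ->
  (forall y, 0 <= gbar y) ->
  measurable_fun setT gbar ->
  (forall x y, nrm (H x y) <= M * (nrm x + gbar y)) ->
  (exists B : R, forall t, (\int[Pr]_w ((`|gbar (xi t w)|) `^ p)%:E <= B%:E)%E) ->
  (* conclusion: (L^p, max{a_t,1} sqrt(eta_t))-consistency *)
  exists Cp : R, 1 <= Cp /\
    forall t : nat,
      (poweR (\int[Pr]_w ((nrm (iterates H eta x0 xi t w - xstar)) `^ p)%:E) p^-1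
        <= (Cp * Num.max (a_seq rho sigma kappa eta t) 1 * Num.sqrt (eta t))%:E)%E.
Proof.
move=> nrmP mc mH piH piH0 p2 sigma0 [BA HA] kH PHsigma HL st _ kappa1 rho01
  mix eta01 eta_noninc eta_cvg0 _ _ _ eta_o _ _ gamma01 c0 contr M0 gbar0
  mgbar HM [Bg gB].
have p0 : 0 < p by lra.
have HLp x y z : (\int[k z]_y' ((nrm (H x y' - H y y')) `^ p)%:E <=
    ((`|LH| * nrm (x - y)) `^ p)%:E)%E.
  apply: poweR_inv_le => //.
  - by apply: integral_ge0 => w _; rewrite lee_fin powR_ge0.
  - by rewrite mulr_ge0// is_norm_ge0.
  - apply: (le_trans (HL x y z)); rewrite lee_fin ler_wpM2r ?is_norm_ge0//.
    exact: ler_norm.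
have HAp t : (\int[Pr]_w ((nrm (H xstar (xi t w))) `^ p)%:E <=
    (`|BA| `^ p)%:E)%E.
  apply: poweR_inv_le => //.
  - by apply: integral_ge0 => w _; rewrite lee_fin powR_ge0.
  - by apply: (le_trans (HA t)); rewrite lee_fin ler_norm.
(* The Poisson equation is scalar, so it is solved in each coordinate; (A2) bounds [P H(xstar, .)]
   in [nrm], and the constant [K] transfers this to the coordinates. *)
have [U [BU [Ub UP]]] : exists U : Xi -> 'rV[R]_d, exists BU,
    (forall i, bmeasurable (fun y => U y 0 i) BU) /\
    forall y i, U y 0 i =
      Pvec k (H xstar) y 0 i + kop k (fun z => U z 0 i) y.
  have [K K0 HK] := coord_le_is_norm nrmP.
  have mHi i : measurable_fun setT (fun z => H xstar z 0 i).
    exact: (@measurable_jointly _ _ _ Xi _ Xi H (fun=> xstar) id i).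
  have fE i : (fun y => Pvec k (H xstar) y 0 i) =
      kop k (fun z => H xstar z 0 i).
    by apply/funext => y; rewrite mxE.
  have pois i : exists Ui : Xi -> R, (exists B, bmeasurable Ui B) /\
      forall y, Ui y = Pvec k (H xstar) y 0 i + kop k Ui y.
    apply: (poisson_equation rho01 mix (B := K * sigma)).
    - by rewrite mulr_ge0// ltW.
    - split; first by rewrite fE; exact: measurable_kop.
      by move=> y; apply: (le_trans (HK _ i)); rewrite ler_wpM2l.
    - rewrite fE (stationary_kop st (piH i)) ?piH0//.
      by move=> y; exact: kH.
  have [V HV] := choice pois.
  have [B HB] := choice (fun i => (HV i).1).
  exists (fun y => \row_i V i y), (\sum_i `|B i|).
  have VE i : (fun y => (\row_j V j y) 0 i) = V i.
    by apply/funext => y; rewrite mxE.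
  split=> [i|y i].
    rewrite VE; case: (HB i) => mV bV; split => // y.
    apply: (le_trans (bV y)); apply: (le_trans (ler_norm _)).
    by rewrite (bigD1 i)//= lerDl sumr_ge0.
  by rewrite VE mxE; exact: (HV i).2.
have eta_small eps : 0 < eps ->
    exists N, forall t, (N <= t)%N -> eta t <= eps.
  move=> eps0; have /cvgrPdist_le/(_ eps eps0)[N _ HN] := eta_cvg0.
  exists N => t /HN /=; rewrite sub0r normrN; apply: le_trans.
  exact: ler_norm.
have eta_reg eps : 0 < eps -> exists N, forall t, (N <= t)%N ->
    0 <= eta t - eta t.+1 <= eps * eta t ^+ 2.
  move=> eps0; have /eqoP/(_ eps eps0)[N _ HN] := eta_o.
  exists N => t Nt; rewrite subr_ge0 eta_noninc/=.
  (* The little-o hypothesis is indexed by the predecessor, so it is read at [t.+1] and multiplied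
     by [eta t]. *)
  have := HN t.+1 (leqW Nt) => /=.
  have e0 : 0 < eta t by case/andP: (eta01 t).
  rewrite normrM normfV (gtr0_norm e0) ler_pdivrMr// => h.
  by apply: (le_trans (ler_norm _)); rewrite expr2 mulrA.
have fin := @iterates_moment_finite _ _ _ _ _ _ _ _ _ _ _ xstar _ nrmP mc
  mH p2 _ x0 eta01 _ _ _ M0 gbar0 mgbar HM gB.
have [C C0 HC] := iterates_moment_rate nrmP mc mH p2 HAp kH (normr_ge0 LH) HLp
  gamma01 c0 contr Ub UP eta01 eta_small eta_reg fin.
exists (1 + C `^ p^-1); split; first by rewrite lerDl powR_ge0.
move=> t; have [e0 e1] := andP (eta01 t).
have s0 : 0 <= Num.sqrt (eta t) by exact: sqrtr_ge0.
apply: (@le_trans _ _ (C `^ p^-1 * Num.sqrt (eta t))%:E).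
  apply: poweR_le_inv => //.
  - by apply: integral_ge0 => w _; rewrite lee_fin powR_ge0.
  - by rewrite mulr_ge0// powR_ge0.
  - apply: (le_trans (HC t)); rewrite lee_fin powRM ?powR_ge0//.
    rewrite -powRrM mulVf ?gt_eqF// powRr1// -powR12_sqrt; last exact: ltW.
    by rewrite -powRrM mulrC [2^-1 * p]mulrC mulrC.
rewrite lee_fin ler_wpM2r// -[leLHS]mulr1; apply: ler_pM.
- exact: powR_ge0.
- exact: ler01.
- by rewrite lerDr.
- by rewrite le_max lexx orbT.
Qed.
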